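(* Let $c_1,c_2>0$ and let $H_1,H_2\in C^\infty(\mathbb T^n\times\mathbb R^n)$. Assume that there exist $\omega_1,\omega_2>0$ such that for $j=1,2$ $$\lim_{|p|\to+\infty}\left[\omega_j|H_j(x,p)|^2+D_xH_j(x,p)\cdot p-16n\,\omega_jc_j^2|p|^2\right]=+\infty\quad\text{uniformly in }x\in\mathbb T^n.$$ Then there exists a unique $\mu\in\mathbb R$ such that $$c_2\overline H_1+c_1\overline H_2=\mu$$ for every pair $(\overline H_1,\overline H_2)\in\mathbb R^2$ such that the system $$\begin{cases}c_1u_1-c_1u_2+H_1(x,Du_1)=\overline H_1\\-c_2u_1+c_2u_2+H_2(x,Du_2)=\overline H_2\end{cases}\quad\text{in }\mathbb T^n$$ admits a viscosity solution $(u_1,u_2)\in C(\mathbb T^n)^2$.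
   Context: $\mathbb T^n=\mathbb R^n/\mathbb Z^n$, $n\ge2$; functions on $\mathbb T^n$ are identified with $\mathbb Z^n$-periodic functions on $\mathbb R^n$. A pair $(u_1,u_2)$ of continuous functions is a viscosity solution of the system if each $u_j$ is a viscosity solution of the $j$-th equation, regarded as a scalar equation for $u_j$ with the other component a given continuous function. *)

(* Defs.v *)
From HB Require Import structures.
From mathcomp Require Import all_boot all_order all_algebra.
From mathcomp Require Import all_classical all_reals all_analysis.
Set Implicit Arguments.
Unset Strict Implicit.
Unset Printing Implicit Defensive.
Import Order.TTheory GRing.Theory Num.Theory.
Import numFieldNormedType.Exports.
Local Open Scope classical_set_scope.
Local Open Scope ring_scope.

(* The library norm on ['rV[R]_n] is the sup norm; [|p|] in the growth condition
   is the Euclidean norm, hence [enorm].  Both induce the same topology. *)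
Definition dotp {R : realType} {n : nat} (u v : 'rV[R]_n) : R :=
  \sum_(i < n) u 0 i * v 0 i.

Definition enorm {R : realType} {n : nat} (p : 'rV[R]_n) : R :=
  Num.sqrt (dotp p p).

Definition unitv {R : realType} {n : nat} (i : 'I_n) : 'rV[R]_n := delta_mx 0 i.

Definition unitv2 {R : realType} {n : nat} (i : 'I_n + 'I_n) :
    'rV[R]_n * 'rV[R]_n :=
  match i with inl j => (unitv j, 0) | inr j => (0, unitv j) end.

Definition grad {R : realType} {n : nat} (f : 'rV[R]_n -> R) (x : 'rV[R]_n) :
    'rV[R]_n :=
  \row_(i < n) 'D_(unitv i) f x.

(* [Ck e k f]: every iterated partial derivative of [f] of order at most [k] in
   the coordinate directions [e] exists everywhere and is continuous. *)
Fixpoint Ck {R : realType} {V : normedModType R} {I : Type} (e : I -> V)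
    (k : nat) (f : V -> R) : Prop :=
  continuous f /\
  match k with
  | 0 => True
  | k'.+1 => forall i : I,
      (forall x : V, derivable f x (e i)) /\ Ck e k' (fun x => 'D_(e i) f x)
  end.

Definition Zn_periodic {R : realType} {n : nat} {T : Type} (f : 'rV[R]_n -> T) :
    Prop :=
  forall (x : 'rV[R]_n) (k : 'rV[int]_n), f (x + map_mx intr k) = f x.

Definition C_torus {R : realType} {n : nat} (u : 'rV[R]_n -> R) : Prop :=
  continuous u /\ Zn_periodic u.

Definition smooth_hamiltonian {R : realType} {n : nat}
    (H : 'rV[R]_n * 'rV[R]_n -> R) : Prop :=
  (forall p : 'rV[R]_n, Zn_periodic (fun x => H (x, p))) /\
  (forall k : nat, Ck unitv2 k H).

Definition growth_condition {R : realType} {n : nat} (c omega : R)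
    (H : 'rV[R]_n * 'rV[R]_n -> R) : Prop :=
  forall M : R, exists r : R, forall x p : 'rV[R]_n, r < enorm p ->
    M < omega * `|H (x, p)| ^+ 2 + dotp (grad (fun y => H (y, p)) x) p
        - 16 * n%:R * omega * c ^+ 2 * enorm p ^+ 2.

(* Viscosity sub- and supersolutions of [F (x, u, Du) = 0] on the whole space;
   the test functions are C^1 on R^n and need not be periodic, since touching
   is only required locally. *)
Definition viscosity_subsolution {R : realType} {n : nat}
    (F : 'rV[R]_n -> R -> 'rV[R]_n -> R) (u : 'rV[R]_n -> R) : Prop :=
  forall (phi : 'rV[R]_n -> R) (x : 'rV[R]_n), Ck unitv 1 phi ->
    (\forall y \near x, u y - phi y <= u x - phi x) ->
    F x (u x) (grad phi x) <= 0.

Definition viscosity_supersolution {R : realType} {n : nat}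
    (F : 'rV[R]_n -> R -> 'rV[R]_n -> R) (u : 'rV[R]_n -> R) : Prop :=
  forall (phi : 'rV[R]_n -> R) (x : 'rV[R]_n), Ck unitv 1 phi ->
    (\forall y \near x, u x - phi x <= u y - phi y) ->
    0 <= F x (u x) (grad phi x).

Definition viscosity_solution {R : realType} {n : nat}
    (F : 'rV[R]_n -> R -> 'rV[R]_n -> R) (u : 'rV[R]_n -> R) : Prop :=
  viscosity_subsolution F u /\ viscosity_supersolution F u.

Definition system_viscosity_solution {R : realType} {n : nat} (c1 c2 : R)
    (H1 H2 : 'rV[R]_n * 'rV[R]_n -> R) (h1 h2 : R) (u1 u2 : 'rV[R]_n -> R) :
    Prop :=
  [/\ C_torus u1, C_torus u2,
      viscosity_solution
        (fun x r p => c1 * r - c1 * u2 x + H1 (x, p) - h1) u1 &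
      viscosity_solution
        (fun x r p => - c2 * u1 x + c2 * r + H2 (x, p) - h2) u2].

(* Main.v *)
Require Import Defs.
From mathcomp Require Import all_boot all_order all_algebra.
From mathcomp Require Import all_classical all_reals all_analysis.
From mathcomp Require Import ring lra.
Set Implicit Arguments.
Unset Strict Implicit.
Unset Printing Implicit Defensive.
Import Order.TTheory GRing.Theory Num.Theory.
Import numFieldNormedType.Exports.
Local Open Scope classical_set_scope.
Local Open Scope ring_scope.

(** Uniqueness of [mu] means two things: the weighted sum [c2 * h1 + c1 * h2] takes
the same value on all solvable pairs, and at least one pair is solvable, since
otherwise every real number would qualify.

Coercivity. Fix a large [p] and put [K = 4 sqrt n c |p|], so that
[K ^ 2 = 16 n c ^ 2 |p| ^ 2]. Along the line [t |-> x + t p] the growth condition says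
that [h t = H (x + t p, p)] satisfies [omega * h ^ 2 + h' > omega * K ^ 2]; hence [h]
increases as long as [|h| < K]. A value in the band [|h| < K] could therefore never be
approached again, whereas the line is recurrent on the torus ([band_avoided]). So
[|H (x, p)| >= K] for all large [p], and since the complement of a ball is connected in
dimension at least two, [H] has a constant sign there ([growth_steep]): either [H] or
its reflection [- H (x, - p)], which governs [- u], is coercive with slope
[4 sqrt n c]. The two Hamiltonians may have opposite signs.

Comparison. Doubling the variables needs coercivity only, because a subsolution (or a
supersolution, according to the sign) bounds the penalisation momenta; it yields a
maximum point of [u - v] where the right-hand sides are ordered ([comparison]). Applied
to both components of two solutions of the system, the coupling terms become
[c1 * (M2 - M1)] and [c2 * (M1 - M2)], where [Mj] is the maximum of [uj - vj]; they
cancel in the weighted sum, which gives the first claim ([ergodic_constant_le]).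

Existence. A scalar equation [lam * u + H (x, Du) = f] is solved by Perron's method
([perron]) and its solution operator is [1 / lam]-Lipschitz in the sup norm by
comparison. Solving alternately for the two components is a contraction when a discount
[delta] is added, so the discounted system is solved up to an arbitrarily small error
([discounted_pair]). At the extrema of the components the equations show that
[delta * uj] is bounded and that the maxima, and the minima, of the two components are
close. The right-hand side of each equation is then bounded by [c] times the
oscillation of the same component, up to a constant; the slope [4 sqrt n c] absorbs
this term, because a periodic function of Lipschitz constant [L] has oscillation at
most [sqrt n * L] ([lip_apriori]). After subtraction of [u1 0] the solutions are
equi-Lipschitz and bounded, and a limit along an ultrafilter solves the system with
[h1 = h2 = - lim delta * u1 0] ([ergodic_existence]). *)

(** * Continuous functions and Euclidean geometry of row vectors *)

Section Continuity.
Context {R : realType} {T : topologicalType} {W : normedModType R}.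

Lemma contD (f g : T -> W) : continuous f -> continuous g ->
  continuous (fun x => f x + g x).
Proof. by move=> hf hg x; apply: cvgD; [exact: hf|exact: hg]. Qed.

Lemma contN (f : T -> W) : continuous f -> continuous (fun x => - f x).
Proof. by move=> hf x; apply: cvgN; exact: hf. Qed.

Lemma contB (f g : T -> W) : continuous f -> continuous g ->
  continuous (fun x => f x - g x).
Proof. by move=> hf hg; apply: contD => //; exact: contN. Qed.

Lemma contC (c : W) : continuous (fun _ : T => c).
Proof. by move=> x; exact: cvg_cst. Qed.

Lemma contZ (f : T -> R) (g : T -> W) : continuous f -> continuous g ->
  continuous (fun x => f x *: g x).
Proof. by move=> hf hg x; apply: cvgZ; [exact: hf|exact: hg]. Qed.

Lemma contM (f g : T -> R) : continuous f -> continuous g ->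
  continuous (fun x => f x * g x).
Proof. by move=> hf hg x; apply: cvgM; [exact: hf|exact: hg]. Qed.

Lemma contP (U1 U2 : topologicalType) (f : T -> U1) (g : T -> U2) :
  continuous f -> continuous g -> continuous (fun x => (f x, g x)).
Proof. by move=> hf hg x; apply: cvg_pair; [exact: hf|exact: hg]. Qed.

Lemma cont_comp (U1 U2 : topologicalType) (f : T -> U1) (g : U1 -> U2) :
  continuous f -> continuous g -> continuous (fun x => g (f x)).
Proof. by move=> hf hg x; apply: continuous_comp; [exact: hf|exact: hg]. Qed.

Lemma cont_id : continuous (fun x : T => x).
Proof. by move=> x. Qed.

Lemma cont_sum (n : nat) (f : 'I_n -> T -> R) : (forall i, continuous (f i)) ->
  continuous (fun x => \sum_(i < n) f i x).
Proof.
move=> hf x; apply: (@cvg_big _ _ _ _ _ (@add_continuous R^o) _ (nbhs x)) => i _.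
exact: hf.
Qed.

End Continuity.

Section Euclid.
Context {R : realType} {n : nat}.
Local Notation V := 'rV[R]_n.
Implicit Types (x y z v a p : V).

Lemma dotpDl x y z : dotp (x + y) z = dotp x z + dotp y z.
Proof. by rewrite /dotp -big_split; apply: eq_bigr => i _; rewrite mxE mulrDl. Qed.

Lemma dotpC x y : dotp x y = dotp y x.
Proof. by apply: eq_bigr => i _; rewrite mulrC. Qed.

Lemma dotpDr x y z : dotp x (y + z) = dotp x y + dotp x z.
Proof. by rewrite dotpC dotpDl !(dotpC x). Qed.

Lemma dotpZl (c : R) x y : dotp (c *: x) y = c * dotp x y.
Proof. by rewrite /dotp mulr_sumr; apply: eq_bigr => i _; rewrite mxE mulrA. Qed.

Lemma dotpZr (c : R) x y : dotp x (c *: y) = c * dotp x y.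
Proof. by rewrite dotpC dotpZl dotpC. Qed.

Lemma dotpNN x : dotp (- x) (- x) = dotp x x.
Proof. by apply: eq_bigr => i _; rewrite !mxE mulrNN. Qed.

Lemma dotp_unitv x i : dotp x (unitv i) = x 0 i.
Proof.
rewrite /dotp (bigD1 i)//= big1 ?addr0 ?mxE ?eqxx ?mulr1// => j ji.
by rewrite mxE (negPf ji) mulr0.
Qed.

Lemma dotpp_ge0 x : 0 <= dotp x x.
Proof. by apply: sumr_ge0 => i _; rewrite -expr2 sqr_ge0. Qed.

Lemma ler_coord_norm x i : `|x 0 i| <= `|x|.
Proof.
rewrite [leRHS]/Num.norm/= mx_normrE.
by apply: (le_bigmax _ (fun j : 'I_1 * 'I_n => `|x j.1 j.2|) (0, i)).
Qed.

Lemma ler_norm_coord x (M : R) : 0 <= M -> (forall i, `|x 0 i| <= M) -> `|x| <= M.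
Proof.
move=> M0 h; rewrite [leLHS]/Num.norm/= mx_normrE.
by apply: bigmax_le => // -[i j] _; rewrite /= ord1.
Qed.

Lemma norm_le_enorm x : `|x| <= enorm x.
Proof.
apply: ler_norm_coord; first exact: sqrtr_ge0.
move=> i; rewrite -sqrtr_sqr ler_wsqrtr// expr2 /dotp (bigD1 i)//= lerDl.
by apply: sumr_ge0 => j _; rewrite -expr2 sqr_ge0.
Qed.

Lemma enorm_le_norm x : enorm x <= Num.sqrt n%:R * `|x|.
Proof.
rewrite -[X in _ * X]ger0_norm// -sqrtr_sqr -sqrtrM// ler_wsqrtr//.
have -> : n%:R * `|x| ^+ 2 = \sum_(i < n) `|x| ^+ 2.
  by rewrite sumr_const card_ord mulr_natl.
apply: ler_sum => i _; rewrite -expr2 -real_normK ?num_real//.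
by rewrite ler_sqr ?nnegrE// ler_coord_norm.
Qed.

Lemma enorm_ge0 x : 0 <= enorm x. Proof. exact: sqrtr_ge0. Qed.

Lemma sqr_enorm x : enorm x ^+ 2 = dotp x x.
Proof. by rewrite sqr_sqrtr// dotpp_ge0. Qed.

Lemma enormZ (c : R) x : enorm (c *: x) = `|c| * enorm x.
Proof. by rewrite /enorm dotpZl dotpZr mulrA -expr2 sqrtrM ?sqr_ge0// sqrtr_sqr. Qed.

Lemma enormN x : enorm (- x) = enorm x.
Proof. by rewrite /enorm dotpNN. Qed.

Lemma coord_cont (i : 'I_n) : continuous (fun x : V => x 0 i).
Proof. exact: coord_continuous. Qed.

Lemma continuous_rowP (T : topologicalType) (g : T -> V) :
  (forall i, continuous (fun t => g t 0 i)) -> continuous g.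
Proof.
move=> h t; apply/cvgrPdist_lt => /= e e0.
suff : \forall s \near t, forall i, `|g t 0 i - g s 0 i| < e.
  apply: filterS => s hs; rewrite [ltLHS]/Num.norm/= mx_normrE.
  by apply/bigmax_ltP; split => // -[i j] _ /=; rewrite ord1 !mxE.
apply: filter_forall => i.
have /cvgrPdist_lt := h i t; exact.
Qed.

Lemma is_derive_lineP (f : V -> R) x v (h d : R) :
  is_derive (h *: v + x) v f d <-> is_derive h 1 (fun s => f (s *: v + x)) d.
Proof.
have E : (fun s : R => s^-1 *: ((f \o shift (h *: v + x)) (s *: v) -
                                f (h *: v + x))) =
  (fun s : R => s^-1 *: (((fun s => f (s *: v + x)) \o shift h) (s *: (1 : R)) -
                                f (h *: v + x))).
  by apply/funext => s /=; rewrite [_ *: (1 : R)]mulr1 scalerDl addrA.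
split=> -[d1 d2]; split.
- by rewrite /derivable /= -E.
- by rewrite -d2 /derive /= -E.
- by rewrite /derivable /= E.
- by rewrite -d2 /derive /= E.
Qed.

Lemma is_derive_chain (g : R -> R) (f : V -> R) x v (d e : R) :
  is_derive x v f d -> is_derive (f x) 1 g e -> is_derive x v (g \o f) (e * d).
Proof.
have -> : x = 0 *: v + x by rewrite scale0r add0r.
move=> /is_derive_lineP df dg; apply/is_derive_lineP.
exact: (@is_derive1_comp _ g (fun s => f (s *: v + x)) 0 e d).
Qed.

Definition sqdist a x : R := dotp (x - a) (x - a).

Lemma dotp_cont (T : topologicalType) (f g : T -> V) :
  continuous f -> continuous g -> continuous (fun t => dotp (f t) (g t)).
Proof.
move=> hf hg; apply: cont_sum => i; apply: contM.
- exact: (cont_comp hf (@coord_cont i)).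
- exact: (cont_comp hg (@coord_cont i)).
Qed.

Lemma sqdist_cont a : continuous (sqdist a).
Proof.
by apply: dotp_cont; apply: contB; by [exact: cont_id | exact: contC].
Qed.

(** For quadratic functions the second-order expansion is exact. *)
Lemma is_derive_taylor (f : V -> R) x v (d e : R) :
  (forall h, f (h *: v + x) = f x + h * d + h * h * e) -> is_derive x v f d.
Proof.
move=> H.
have c : (fun h : R => h^-1 *: ((f \o shift x) (h *: v) - f x)) @ 0^' --> d.
  have : (fun h : R => d + h * e) @ 0^' --> d.
    have -> : d = d + 0 * e by rewrite mul0r addr0.
    rewrite {1}mul0r addr0; apply: cvgD; first exact: cvg_cst.
    apply: cvgM; [exact: (cvg_within _) | exact: cvg_cst].
  apply: cvg_trans; apply: near_eq_cvg; near=> h.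
  have h0 : h != 0 by near: h; exact: nbhs_dnbhs_neq.
  rewrite /= H /GRing.scale/=; field.
  exact: h0.
by apply: DeriveDef; [apply/cvg_ex; exists d | exact/cvg_lim].
Unshelve. all: by end_near. Qed.

Lemma is_derive_sqdist a x v : is_derive x v (sqdist a) (2 * dotp (x - a) v).
Proof.
apply: (@is_derive_taylor _ _ _ _ (dotp v v)) => h.
rewrite /sqdist -addrA; move: (x - a) => w.
rewrite !dotpDl !dotpDr !dotpZl !dotpZr (dotpC v w); ring.
Qed.

(** Announcing the gradient in advance gives membership in the class and the value of
[grad] at the same time. *)
Lemma C1_intro (f : V -> R) (g : V -> V) :
  (forall x i, is_derive x (unitv i) f (g x 0 i)) -> continuous f ->
  continuous g -> Ck unitv 1 f /\ grad f = g.
Proof.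
move=> df cf cg; split; last first.
  by apply/funext => x; apply/rowP => i; rewrite mxE; case: (df x i).
split=> // i; split=> [x|]; first by case: (df x i).
split=> //= x.
have -> : (fun y => 'D_(unitv i) f y) = (fun y => g y 0 i).
  by apply/funext => y; case: (df y i).
apply: (@continuous_comp _ _ _ g (fun v : V => v 0 i)); first exact: cg.
exact: coord_cont.
Qed.

Lemma C1_cont (f : V -> R) : Ck unitv 1 f -> continuous f.
Proof. by case. Qed.

Lemma C1_is_derive (f : V -> R) : Ck unitv 1 f ->
  forall x i, is_derive x (unitv i) f (grad f x 0 i).
Proof. by move=> [_ h] x i; rewrite mxE; apply: derivableP; apply (h i).1. Qed.

Lemma C1_grad_cont (f : V -> R) : Ck unitv 1 f -> continuous (grad f).
Proof.
move=> [_ h]; apply: continuous_rowP => i.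
have -> : (fun t => grad f t 0 i) = (fun t => 'D_(unitv i) f t).
  by apply/funext => t; rewrite mxE.
exact: (h i).2.1.
Qed.

Lemma C1D (f g : V -> R) : Ck unitv 1 f -> Ck unitv 1 g ->
  Ck unitv 1 (fun x => f x + g x) /\
  grad (fun x => f x + g x) = (fun x => grad f x + grad g x).
Proof.
move=> hf hg; apply: C1_intro => [x i||].
- have := C1_is_derive hf x i; have := C1_is_derive hg x i => dg df.
  by rewrite mxE; apply: is_deriveD.
- by apply: contD; exact: C1_cont.
- by apply: contD; exact: C1_grad_cont.
Qed.

Lemma C1N (f : V -> R) : Ck unitv 1 f ->
  Ck unitv 1 (fun x => - f x) /\ grad (fun x => - f x) = (fun x => - grad f x).
Proof.
move=> hf; apply: C1_intro => [x i||].
- by have df := C1_is_derive hf x i; rewrite mxE; apply: is_deriveN.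
- by apply: contN; exact: C1_cont.
- by apply: contN; exact: C1_grad_cont.
Qed.

Lemma C1_sqdist (c : R) a : Ck unitv 1 (fun x => c * sqdist a x) /\
  grad (fun x => c * sqdist a x) = (fun x => (2 * c) *: (x - a)).
Proof.
apply: C1_intro => [x i||].
- have dq := is_derive_sqdist a x (unitv i).
  have := is_deriveZ c dq; rewrite /GRing.scale/= dotp_unitv => h.
  by apply: is_derive_eq; rewrite !mxE; ring.
- by apply: contM; [exact: contC | exact: sqdist_cont].
- apply: contZ; first exact: contC.
  by apply: contB; [exact: cont_id | exact: contC].
Qed.

Lemma C1_cst (c : R) : Ck unitv 1 (fun _ : V => c) /\
  grad (fun _ : V => c) = (fun _ => 0).
Proof.
apply: C1_intro => [x i||]; [|exact: contC|exact: contC].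
by rewrite mxE; exact: is_derive_cst.
Qed.

(** Fermat's theorem on each coordinate line. *)
Lemma grad_local_max (f : V -> R) x : Ck unitv 1 f ->
  (\forall y \near x, f y <= f x) -> grad f x = 0.
Proof.
move=> hf hmax; apply/rowP => i; rewrite [RHS]mxE.
pose l := fun h : R => (h *: unitv i + x : V).
have lc : continuous l.
  apply: contD; last exact: contC.
  by apply: contZ; [exact: cont_id | exact: contC].
have l0 : l 0 = x by rewrite /l scale0r add0r.
have : \forall h \near (0 : R), f (l h) <= f x.
  have := lc 0; rewrite /continuous_at l0 => /(_ _ hmax); exact.
move=> /nbhs_ballP[e /= e0 he].
have dl h : is_derive (h : R) 1 (f \o l) (grad f (l h) 0 i).
  exact/is_derive_lineP/C1_is_derive.
have H : is_derive (0 : R) 1 (f \o l) 0.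
  apply: (@derive1_at_max _ (f \o l) (- e) e 0).
  - by rewrite ge0_cp// ltW.
  - by move=> t _; case: (dl t).
  - by rewrite in_itv/= oppr_lt0 e0.
  - move=> t; rewrite in_itv/= => te; rewrite /= l0; apply: he.
    by rewrite /ball/= sub0r normrN ltr_norml.
by have [_ <-] := H; have [_] := dl 0; rewrite l0.
Qed.

Lemma grad_touching (f g : V -> R) x : Ck unitv 1 f -> Ck unitv 1 g ->
  (\forall y \near x, f y - g y <= f x - g x) -> grad g x = grad f x.
Proof.
move=> hf hg hx; have [hN gN] := C1N hg; have [hD gD] := C1D hf hN.
have := grad_local_max hD hx.
by rewrite gD gN => /eqP; rewrite subr_eq0 => /eqP.
Qed.

(** Smoothed cones with vertex [a]: test functions of bounded slope. *)
Lemma C1_sqrt_sqdist (A eta : R) a : 0 < eta ->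
  Ck unitv 1 (fun x => A * Num.sqrt (eta + sqdist a x)) /\
  grad (fun x => A * Num.sqrt (eta + sqdist a x)) =
    (fun x => (A / Num.sqrt (eta + sqdist a x)) *: (x - a)).
Proof.
move=> eta0.
have q0 x : 0 < eta + sqdist a x by rewrite ltr_wpDr// dotpp_ge0.
have qc : continuous (fun x => Num.sqrt (eta + sqdist a x)).
  apply: (cont_comp _ (@sqrt_continuous R)).
  by apply: contD; [exact: contC | exact: sqdist_cont].
apply: C1_intro => [x i||].
- have dq := is_deriveD (is_derive_cst eta x (unitv i))
    (is_derive_sqdist a x (unitv i)).
  have ds := is_derive_chain dq (is_derive1_sqrt (q0 x)).
  have := is_deriveZ A ds; rewrite /GRing.scale/= dotp_unitv => h.
  apply: is_derive_eq; rewrite !mxE.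
  have s0 : Num.sqrt (eta + sqdist a x) != 0 by rewrite gt_eqF// sqrtr_gt0.
  by field; rewrite s0.
- by apply: contM => //; exact: contC.
- apply: contZ; last by apply: contB; [exact: cont_id | exact: contC].
  move=> x; have FF := nbhs_filter x; apply: cvgM; first exact: cvg_cst.
  by apply: cvgV; [rewrite gt_eqF// sqrtr_gt0 | exact: qc].
Qed.

End Euclid.

(** * Compactness, periodicity and limits along ultrafilters *)

Lemma near_all (T : topologicalType) (P : T -> Prop) (x : T) :
  (forall y, P y) -> \forall y \near x, P y.
Proof. by move=> h; exact: nearW. Qed.

Section Compactness.
Context {R : realType} {n : nat}.
Local Notation V := 'rV[R]_n.
Implicit Types (x y a p : V).

Lemma near_norm (P : V -> Prop) x : (\forall y \near x, P y) ->
  exists e : R, 0 < e /\ forall y, `|y - x| < e -> P y.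
Proof.
move=> /nbhs_normP[e /= e0 h]; exists e; split=> // y yx; apply: h.
by rewrite /= distrC.
Qed.

Lemma norm_near (P : V -> Prop) x (e : R) : 0 < e ->
  (forall y, `|y - x| < e -> P y) -> \forall y \near x, P y.
Proof.
move=> e0 h; apply/nbhs_normP; exists e => //= y yx; apply: h.
by rewrite distrC.
Qed.

Lemma near_in_ball x a (e : R) : `|x - a| < e -> \forall y \near x, `|y - a| < e.
Proof.
move=> xa; apply: (@norm_near _ _ (e - `|x - a|)); first by rewrite subr_gt0.
move=> y hy; rewrite -(subrK x y) -addrA (le_lt_trans (ler_normD _ _))//.
by rewrite -ltrBrDr.
Qed.

Lemma cont_norm (f : V -> R) x (e : R) : continuous f -> 0 < e ->
  exists d : R, 0 < d /\ forall y, `|y - x| < d -> `|f y - f x| < e.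
Proof.
move=> fc e0; apply: near_norm.
have /cvgrPdist_lt/(_ _ e0) := fc x.
by apply: filterS => y; rewrite distrC.
Qed.

Lemma compact_norm_ball a (r : R) : compact [set x : V | `|x - a| <= r].
Proof.
apply: bounded_closed_compact.
  exists (`|a| + r); split; first by rewrite num_real.
  move=> M hM x /= xa; apply: le_trans (ltW hM).
  rewrite -(subrK a x) addrC; apply: le_trans (ler_normD _ _) _.
  by rewrite lerD2l.
have c : continuous (fun x => `|x - a|).
  apply: (cont_comp _ (@norm_continuous R V)).
  by apply: contB; [exact: cont_id | exact: contC].
exact: (closed_comp (fun x _ => c x) (@closed_le _ r)).
Qed.

Lemma ball_max (f : V -> R) a (r : R) : continuous f -> 0 <= r ->
  exists c : V, `|c - a| <= r /\ forall y, `|y - a| <= r -> f y <= f c.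
Proof.
move=> fc r0.
have [|c] := EVT_max_rV _ (@compact_norm_ball a r) (continuous_subspaceT fc).
  by exists a; rewrite /= subrr normr0.
rewrite inE /= => ca h; exists c; split=> // y ya.
by apply: h; rewrite inE.
Qed.

(** A maximum over the whole space exists once the values outside a ball do not exceed
the value at its centre. *)
Lemma global_max (f : V -> R) a (r : R) : continuous f ->
  (forall y, r < `|y - a| -> f y <= f a) -> exists c : V, forall y, f y <= f c.
Proof.
move=> fc h.
have r0 : 0 <= Num.max 0 r by rewrite le_max lexx.
have [c [_ hc]] := ball_max a fc r0.
exists c => y; have [yr|yr] := leP `|y - a| (Num.max 0 r); first exact: hc.
apply: le_trans (hc a _); last by rewrite subrr normr0.
by apply: h; rewrite (le_lt_trans _ yr)// le_max lexx orbT.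
Qed.

(** Integer translations bring every point into a fixed compact cube; this is the form
in which compactness of the torus is used. *)
Lemma unit_translate x a :
  exists k : 'rV[int]_n, `|x + map_mx intr k - a| <= 1.
Proof.
exists (\row_i - Num.floor (x 0 i - a 0 i)); apply: ler_norm_coord => // i.
rewrite !mxE mulrNz.
have := floor_itv (x 0 i - a 0 i); rewrite intrD1.
move: (_%:~R) => m /andP[h1 h2]; rewrite ger0_norm; lra.
Qed.

Lemma torus_max (u : V -> R) : C_torus u -> exists c : V, forall y, u y <= u c.
Proof.
move=> [uc up]; have [c [_ hc]] := ball_max 0 uc ler01.
exists c => y; have [k hk] := unit_translate y 0.
by rewrite -(up y k); exact: hc.
Qed.

Lemma C_torusN (u : V -> R) : C_torus u -> C_torus (fun x => - u x).
Proof. by move=> [uc up]; split; [exact: contN | move=> x k; rewrite up]. Qed.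

Lemma C_torusD (u v : V -> R) : C_torus u -> C_torus v ->
  C_torus (fun x => u x + v x).
Proof.
move=> [uc up] [vc vp]; split; first exact: contD.
by move=> x k; rewrite up vp.
Qed.

Lemma C_torusC (c : R) : C_torus (fun _ : V => c).
Proof. by split; [exact: contC | move=> x k]. Qed.

Lemma C_torusZ (c : R) (u : V -> R) : C_torus u -> C_torus (fun x => c * u x).
Proof.
by move=> [uc up]; split; [apply: contM => //; exact: contC | move=> x k; rewrite up].
Qed.

Lemma torus_min (u : V -> R) : C_torus u -> exists c : V, forall y, u c <= u y.
Proof.
move=> /C_torusN/torus_max[c hc]; exists c => y.
by have := hc y; rewrite lerN2.
Qed.

Lemma torus_bounded (u : V -> R) : C_torus u -> exists B, 0 < B /\ forall x, `|u x| <= B.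
Proof.
move=> hu; have [a ha] := torus_max hu; have [b hb] := torus_min hu.
exists (`|u a| + `|u b| + 1); split.
  by rewrite ltr_wpDl// addr_ge0.
move=> x; rewrite ler_norml; have := ha x; have := hb x.
have := ler_norm (u a); have := ler_norm (- u b); rewrite normrN.
have := normr_ge0 (u a); have := normr_ge0 (u b); move=> *; apply/andP; split; lra.
Qed.

End Compactness.

Lemma ultra_map (S T : Type) (f : S -> T) (F : set_system S) :
  UltraFilter F -> UltraFilter (f @ F).
Proof.
move=> FU; split; first exact: fmap_proper_filter.
move=> G GP FG; apply/seteqP; split=> A; last exact: FG.
move=> GA; have [//|nA] := in_ultra_setVsetC (f @^-1` A) FU.
have GnA : G (~` A) by apply: FG.
by have [x []] := filter_ex (filterI GA GnA).
Qed.

(** Along an ultrafilter on [nat] every bounded sequence converges, so several limits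
can be taken at once without extracting subsequences. *)
Section UltraLimits.
Context {R : realType} {n : nat} {U : set_system nat} {UU : UltraFilter U}.

Lemma ultra_lim_rV (x : nat -> 'rV[R]_n) (B : R) : (forall k, `|x k| <= B) ->
  exists l : 'rV[R]_n, x @ U --> l.
Proof.
move=> hB.
have := @compact_norm_ball R n 0 B; rewrite compact_ultra => /(_ (x @ U)).
case.
- exact: ultra_map.
- change (U [set k | `|x k - 0| <= B]).
  by apply: filterE => k /=; rewrite subr0; exact: hB.
- by move=> l [_ hl]; exists l.
Qed.

Lemma ultra_lim (x : nat -> R) (B : R) : (forall k, `|x k| <= B) ->
  exists l : R, x @ U --> l.
Proof.
move=> hB; have := @segment_compact R (- B) B; rewrite compact_ultra => /(_ (x @ U)).
case.
- exact: ultra_map.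
- change (U [set k | x k \in `[- B, B]]).
  by apply: filterE => k /=; rewrite in_itv/= -ler_norml; exact: hB.
- by move=> l [_ hl]; exists l.
Qed.

Lemma ultra_le (x y : nat -> R) (a b : R) : x @ U --> a -> y @ U --> b ->
  (forall k, x k <= y k) -> a <= b.
Proof. by move=> xa yb h; apply: (ler_cvg_to xa yb); exact: filterE. Qed.

Lemma ultra_cont (S T : topologicalType) (f : S -> T) (x : nat -> S) l :
  continuous f -> x @ U --> l -> (fun k => f (x k)) @ U --> f l.
Proof. by move=> fc xl; apply: (continuous_cvg _ (fc l) xl). Qed.

Lemma ultra_cont2 (S1 S2 T : topologicalType) (f : S1 * S2 -> T)
    (a : nat -> S1) (b : nat -> S2) la lb : continuous f ->
  a @ U --> la -> b @ U --> lb -> (fun k => f (a k, b k)) @ U --> f (la, lb).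
Proof.
by move=> fc ha hb; apply: (@ultra_cont _ _ f (fun k => (a k, b k)) (la, lb)) => //;
  exact: cvg_pair.
Qed.

End UltraLimits.

Lemma ex_ultra_infty : exists U : set_system nat, UltraFilter U /\ \oo `<=` U.
Proof. exact: ultraFilterLemma. Qed.

(** * Viscosity inequalities and comparison *)

Section Viscosity.
Context {R : realType} {n : nat}.
Local Notation V := 'rV[R]_n.
Implicit Types (x y a p : V) (H : V * V -> R) (u v f g phi : V -> R).

(** Viscosity inequalities for [H (x, Du) = g x]. Terms of order zero are not part of
the operator: for [lam * u + H (x, Du) = f] the right-hand side is
[g = f - lam * u], with [u] the function under consideration. *)
Definition vsub H g u : Prop :=
  forall phi x, Ck unitv 1 phi ->
    (\forall y \near x, u y - phi y <= u x - phi x) -> H (x, grad phi x) <= g x.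

Definition vsup H g u : Prop :=
  forall phi x, Ck unitv 1 phi ->
    (\forall y \near x, u x - phi x <= u y - phi y) -> g x <= H (x, grad phi x).

Definition coercive H : Prop :=
  forall C : R, exists r : R, forall x p, H (x, p) <= C -> `|p| <= r.

(** Hamiltonian of the equation solved by [- u] when [u] solves the one for [H]:
subsolutions and supersolutions are exchanged. *)
Definition flipH H : V * V -> R := fun z => - H (z.1, - z.2).

Lemma flipHK H : flipH (flipH H) = H.
Proof. by apply/funext => -[x p]; rewrite /flipH /= !opprK. Qed.

Lemma flipH_cont H : continuous H -> continuous (flipH H).
Proof.
move=> hc; apply: contN; apply: (cont_comp _ hc); apply: contP.
  by move=> z; exact: cvg_fst.
by apply: contN => z; exact: cvg_snd.
Qed.

Lemma vsupN H g u :
  vsup H g u <-> vsub (flipH H) (fun x => - g x) (fun x => - u x).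
Proof.
split=> h phi x hphi hx; have [hN gN] := C1N hphi.
- have := h _ x hN; rewrite gN /flipH /= lerN2; apply.
  by apply: filterS hx => y; lra.
- have := h _ x hN; rewrite gN /flipH /= !opprK lerN2; apply.
  by apply: filterS hx => y; lra.
Qed.

Lemma vsubN H g u :
  vsub H g u <-> vsup (flipH H) (fun x => - g x) (fun x => - u x).
Proof.
rewrite vsupN flipHK.
have -> : (fun x => - - g x) = g by apply/funext => x; rewrite opprK.
by have -> : (fun x => - - u x) = u by apply/funext => x; rewrite opprK.
Qed.

Lemma vsub_at_max H g u x : vsub H g u -> (forall y, u y <= u x) ->
  H (x, 0) <= g x.
Proof.
move=> h hx; have [h1 h2] := C1_cst (n := n) (R := R) 0.
have := h _ x h1; rewrite h2; apply; apply: near_all => y.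
by rewrite !subr0.
Qed.

Lemma vsup_at_min H g u x : vsup H g u -> (forall y, u x <= u y) ->
  g x <= H (x, 0).
Proof.
move=> /vsupN h hx; have := vsub_at_max (x := x) h.
by rewrite /flipH /= oppr0 lerN2; apply => y; rewrite lerN2.
Qed.

Lemma vsub_le H g g' u : (forall x, g x <= g' x) -> vsub H g u -> vsub H g' u.
Proof. by move=> gg' h phi x hphi hx; apply: le_trans (gg' x); exact: h. Qed.

Lemma vsup_ge H g g' u : (forall x, g' x <= g x) -> vsup H g u -> vsup H g' u.
Proof. by move=> gg' h phi x hphi hx; apply: le_trans (gg' x) _; exact: h. Qed.

Lemma vsub_shift H g u (c : R) : vsub H g u -> vsub H g (fun x => u x - c).
Proof. by move=> h phi x hphi hx; apply: h => //; apply: filterS hx => y; lra. Qed.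

Lemma vsup_shift H g u (c : R) : vsup H g u -> vsup H g (fun x => u x - c).
Proof. by move=> h phi x hphi hx; apply: h => //; apply: filterS hx => y; lra. Qed.

Lemma cst_vsub H g (c : R) : (forall x, H (x, 0) <= g x) -> vsub H g (fun _ => c).
Proof.
move=> h phi x hphi hx.
have [h1 h2] := C1_cst (n := n) c.
rewrite (grad_touching h1 hphi hx) h2; exact: h.
Qed.

Lemma sqdistC x y : sqdist x y = sqdist y x.
Proof. by rewrite /sqdist -opprB dotpNN. Qed.

Lemma sqdistxx x : sqdist x x = 0.
Proof. by rewrite /sqdist subrr /dotp big1 // => i _; rewrite mxE mul0r. Qed.

Lemma sqdist_ge x a : `|x - a| ^+ 2 <= sqdist a x.
Proof. by rewrite /sqdist -sqr_enorm ler_sqr ?nnegrE ?enorm_ge0// norm_le_enorm. Qed.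

(** The maximum of the doubled function is attained: it is invariant under
simultaneous integer translations of both variables, and the penalisation
confines their difference. *)
Lemma doubled_max u v : C_torus u -> C_torus v -> exists rho : R,
  forall K : R, 1 <= K -> exists x y : V, `|x| <= rho /\
  forall x' y', u x' - v y' - K * sqdist y' x' <= u x - v y - K * sqdist y x.
Proof.
move=> hu hv; have [B1 [B10 hB1]] := torus_bounded hu.
have [B2 [B20 hB2]] := torus_bounded hv.
(* differences larger than s cost more than the oscillation of u and v together *)
pose B := B1 + B2; pose s := 2 * B + 1.
exists 1 => K K1.
pose Phi (z : V * V) := u z.1 - v z.2 - K * dotp (z.1 - z.2) (z.1 - z.2).
have c1 : continuous (fst : V * V -> V) by move=> z; exact: cvg_fst.
have c2 : continuous (snd : V * V -> V) by move=> z; exact: cvg_snd.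
have Pc : continuous Phi.
  apply: contB; last first.
    by apply: contM; [exact: contC | apply: dotp_cont; exact: contB].
  apply: contB; first exact: (cont_comp c1 hu.1).
  exact: (cont_comp c2 hv.1).
pose A := [set x : V | `|x - 0| <= 1] `*` [set x : V | `|x - 0| <= 1 + s].
have cA : compact A by apply: compact_setX; exact: compact_norm_ball.
have B0 : 0 < B by rewrite addr_gt0.
have A0 : A (0, 0).
  by split; rewrite /= subrr normr0 // addr_ge0 // /s; lra.
have [|[x y]] := compact_EVT_max _ cA (continuous_subspaceT Pc).
  by exists (0, 0).
rewrite inE => -[/=]; rewrite !subr0 => hx hy hmax.
exists x, y; split=> // x' y'.
have [k hk] := unit_translate x' 0.
set kk := map_mx intr k in hk.
have shiftK : x' + kk - (y' + kk) = x' - y' by rewrite opprD addrACA subrr addr0.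
have -> : u x' - v y' - K * sqdist y' x' = Phi (x' + kk, y' + kk).
  by rewrite /Phi /= hu.2 hv.2 shiftK.
have [yk|yk] := leP `|y' + kk - 0| (1 + s).
  by apply: hmax; rewrite inE.
apply: (@le_trans _ _ (Phi (0, 0))); last by apply: hmax; rewrite inE.
rewrite /Phi /= hu.2 hv.2 shiftK.
have -> : dotp (0 - 0 : V) (0 - 0) = 0 by exact: sqdistxx.
have d : s < `|x' - y'|.
  have : `|y' + kk| <= `|x' + kk| + `|x' - y'|.
    have -> : y' + kk = (x' + kk) - (x' - y').
      by rewrite -addrA (addrC kk) addrA opprB addrCA subrr addr0.
    exact: ler_normB.
  by move: hk yk; rewrite !subr0; lra.
have d2 : s ^+ 2 <= sqdist y' x'.
  apply: le_trans (sqdist_ge _ _); rewrite ler_sqr ?nnegrE//; first exact: ltW.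
  by rewrite /s; lra.
have := hB1 x'; have := hB1 0; have := hB2 y'; have := hB2 0.
rewrite !ler_norml => /andP[q1 q2] /andP[q3 q4] /andP[q5 q6] /andP[q7 q8].
have : sqdist y' x' <= K * sqdist y' x'.
  by rewrite ler_peMl // dotpp_ge0.
have : 2 * B <= s ^+ 2 by rewrite /s; nra.
rewrite -/(sqdist y' x') /B; lra.
Qed.

(** Comparison by doubling of variables. The penalisation momenta stay bounded by
coercivity alone, and every cluster point of the doubled maximisers is a maximiser of
[u - v] at which the two equations see the same momentum. *)
Lemma comparison H f g u v : continuous H -> coercive H \/ coercive (flipH H) ->
  C_torus f -> C_torus g -> C_torus u -> C_torus v ->
  vsub H f u -> vsup H g v ->
  exists xh : V, (forall y, u y - v y <= u xh - v xh) /\ g xh <= f xh.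
Proof.
move=> Hc hco hf hg hu hv su sv.
have [rho hmax] := doubled_max hu hv.
have [Bf [_ hBf]] := torus_bounded hf; have [Bg [_ hBg]] := torus_bounded hg.
have [r hr] : exists r : R, forall x y p, H (x, p) <= f x -> g y <= H (y, p) ->
    `|p| <= r.
  case: hco => hco.
    have [r hr] := hco Bf; exists r => x y p h _; apply: (hr x).
    by apply: le_trans h _; have := hBf x; rewrite ler_norml => /andP[].
  have [r hr] := hco Bg; exists r => x y p _ h; rewrite -normrN; apply: (hr y).
  rewrite /flipH /= opprK; have := hBg y; rewrite ler_norml; lra.
(* z is the pair (x, p); the second point y is recovered as x - p / (2 (k + 1)) *)
have step (k : nat) : exists z : V * V,
    [/\ `|z.1| <= rho, `|z.2| <= r, H z <= f z.1 &
     let y := z.1 - (2^-1 * harmonic k) *: z.2 in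
     g y <= H (y, z.2) /\ forall w, u w - v w <= u z.1 - v y].
  have K1 : 1 <= k.+1%:R :> R by rewrite ler1n.
  have [x [y [hx hm]]] := hmax _ K1.
  pose p := (2 * k.+1%:R) *: (x - y).
  have [q1 q2] := C1_sqdist k.+1%:R y.
  have [q3 q4] := C1_sqdist (- k.+1%:R) x.
  have h1 : H (x, p) <= f x.
    have := su _ x q1; rewrite q2; apply; apply: near_all => x'.
    by have := hm x' y; lra.
  have h2 : g y <= H (y, p).
    have := sv _ y q3; rewrite q4.
    have -> : (2 * - k.+1%:R) *: (y - x) = p.
      by rewrite /p -(opprB x y) scalerN mulrN scaleNr opprK.
    apply; apply: near_all => y'.
    by have := hm x y'; rewrite !(sqdistC x); lra.
  exists (x, p); split=> //=; first exact: (hr x y).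
  have -> : x - (2^-1 * harmonic k) *: p = y.
    rewrite /p scalerA /harmonic /=.
    have -> : 2^-1 * k.+1%:R^-1 * (2 * k.+1%:R) = 1 :> R.
      have := pnatr_eq0 R k.+1; move: (k.+1%:R) => m /negbT m0; field.
      exact: m0.
    by rewrite scale1r opprB addrC subrK.
  split=> // w; have := hm w w; rewrite sqdistxx.
  have : 0 <= k.+1%:R * sqdist y x by rewrite mulr_ge0 // dotpp_ge0.
  lra.
have [z hz] := choice step.
have [U [UU Uoo]] := ex_ultra_infty.
have [xh hxh] : exists l : V, (fun k => (z k).1) @ U --> l.
  by apply: (@ultra_lim_rV _ _ _ _ _ rho) => k; case: (hz k).
have [ph hph] : exists l : V, (fun k => (z k).2) @ U --> l.
  by apply: (@ultra_lim_rV _ _ _ _ _ r) => k; case: (hz k).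
pose y k := (z k).1 - (2^-1 * harmonic k) *: (z k).2.
have hy : y @ U --> xh.
  have -> : xh = xh - (2^-1 * 0) *: ph by rewrite mulr0 scale0r subr0.
  apply: cvgB => //; apply: cvgZ => //; apply: cvgM; first exact: cvg_cst.
  exact: cvg_trans (cvg_app _ Uoo) (@cvg_harmonic R).
have L1 : H (xh, ph) <= f xh.
  apply: (@ultra_le _ U _ (fun k => H ((z k).1, (z k).2)) (fun k => f (z k).1)).
  - exact: (ultra_cont2 Hc hxh hph).
  - exact: (ultra_cont hf.1 hxh).
  - by move=> k; rewrite -surjective_pairing; case: (hz k).
have L2 : g xh <= H (xh, ph).
  apply: (@ultra_le _ U _ (fun k => g (y k)) (fun k => H (y k, (z k).2))).
  - exact: (ultra_cont hg.1 hy).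
  - exact: (ultra_cont2 Hc hy hph).
  - by move=> k; case: (hz k) => _ _ _ [].
exists xh; split; last exact: le_trans L2 L1.
move=> w.
apply: (@ultra_le _ U _ (fun k => u w - v w) (fun k => u (z k).1 - v (y k))).
- exact: cvg_cst.
- exact: (cvgB (ultra_cont hu.1 hxh) (ultra_cont hv.1 hy)).
- by move=> k; case: (hz k) => _ _ _ [].
Qed.

End Viscosity.

(** * Lipschitz bounds and stability *)

Section Regularity.
Context {R : realType} {n : nat}.
Local Notation V := 'rV[R]_n.
Implicit Types (x y z a p : V) (H : V * V -> R) (u v f g phi : V -> R).

Lemma lipschitz_cont u (K : R) :
  (forall x z, u z - u x <= K * enorm (z - x)) -> continuous u.
Proof.
move=> hu x; have FF := nbhs_filter x; apply/cvgrPdist_lt => e e0.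
pose M := `|K| * Num.sqrt n%:R + 1.
have M0 : 0 < M by rewrite ltr_wpDl// mulr_ge0.
apply: (@norm_near _ _ _ _ (e / M)); first by rewrite divr_gt0.
move=> y; rewrite ltr_pdivlMr// => hy.
have b z : K * enorm z <= M * `|z|.
  apply: (@le_trans _ _ (`|K| * (Num.sqrt n%:R * `|z|))).
    apply: (@le_trans _ _ (`|K| * enorm z)).
      by rewrite ler_wpM2r ?enorm_ge0 ?ler_norm.
    by rewrite ler_wpM2l ?enorm_le_norm.
  by rewrite mulrA /M mulrDl lerDl mul1r.
have := hu x y; have := hu y x; have := b (x - y); have := b (y - x).
rewrite (distrC x y) ltr_norml; move: hy; rewrite mulrC.
by move=> *; apply/andP; split; lra.
Qed.

(** A bound on the gradients of touching functions is a Lipschitz bound: slide the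
smoothed cone of slope [L + 1] down from above; its contact point stays within
[L * sqrt eta] of the vertex. *)
Lemma lipschitz_of_vsub u (L B : R) : 0 <= L -> continuous u ->
  (forall x, `|u x| <= B) -> vsub (fun z : V * V => enorm z.2) (fun _ => L) u ->
  forall x z, u z - u x <= (L + 1) * enorm (z - x).
Proof.
move=> L0 uc uB su x z; apply/ler_addgt0Pl => e e0.
pose e' := e / 2.
have e'0 : 0 < e' by rewrite divr_gt0.
have [d [d0 hd]] := cont_norm x uc e'0.
pose A := L + 1.
have A0 : 0 < A by rewrite /A; lra.
pose s := Num.min (d / (2 * A)) (e' / A).
have s0 : 0 < s by rewrite lt_min !divr_gt0// mulr_gt0.
have sd : L * s < d.
  apply: (@le_lt_trans _ _ (L * (d / (2 * A)))).
    by rewrite ler_wpM2l// /s ge_min lexx.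
  rewrite mulrA ltr_pdivrMr ?mulr_gt0//; rewrite /A; nra.
have se : A * s <= e'.
  by rewrite mulrC -ler_pdivlMr// /s ge_min lexx orbT.
have eta0 : 0 < s ^+ 2 by rewrite exprn_gt0.
have [Pc Pg] := C1_sqrt_sqdist A x eta0.
set phi := (fun y => _) in Pc Pg.
have q0 y : 0 <= sqdist x y by exact: dotpp_ge0.
have phix : phi x = A * s.
  by rewrite /phi sqdistxx addr0 sqrtr_sqr gtr0_norm.
have philo y : enorm (y - x) <= phi y.
  rewrite /phi -[leLHS]mul1r; apply: ler_pM => //; first exact: enorm_ge0.
    by rewrite /A; lra.
  by rewrite ler_wsqrtr// lerDr sqr_ge0.
have phihi y : phi y <= A * s + A * enorm (y - x).
  rewrite /phi -mulrDr ler_pM2l//.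
  rewrite -[leRHS]ger0_norm ?addr_ge0 ?enorm_ge0 ?(ltW s0)// -sqrtr_sqr.
  rewrite ler_wsqrtr// sqrrD sqr_enorm -/(sqdist x y).
  by rewrite [leRHS]addrAC lerDl mulrn_wge0// mulr_ge0 ?enorm_ge0 ?(ltW s0).
have [||y hy] := @global_max _ _ (fun y => u y - phi y) x (2 * B + A * s).
- by apply: contB => //; exact: C1_cont.
- move=> y hy; have := le_trans (norm_le_enorm (y - x)) (philo y).
  have := uB x; have := uB y; rewrite !ler_norml => /andP[? ?] /andP[? ?].
  by move: hy; rewrite phix; lra.
have gy : enorm (grad phi y) <= L by apply: (su _ y Pc); exact: near_all.
move: gy; rewrite Pg enormZ => gy.
have S0 : 0 < Num.sqrt (s ^+ 2 + sqdist x y) by rewrite sqrtr_gt0 ltr_pwDl.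
have yd : enorm (y - x) <= L * s.
  move: gy; rewrite ger0_norm ?divr_ge0 ?(ltW A0) ?(ltW S0)//.
  rewrite mulrAC ler_pdivrMr// => gy.
  have gy2 : A ^+ 2 * sqdist x y <= L ^+ 2 * (s ^+ 2 + sqdist x y).
    have -> : s ^+ 2 + sqdist x y = Num.sqrt (s ^+ 2 + sqdist x y) ^+ 2.
      by rewrite sqr_sqrtr// addr_ge0// sqr_ge0.
    rewrite /sqdist -sqr_enorm -!exprMn ler_sqr ?nnegrE ?mulr_ge0 ?enorm_ge0//.
      by rewrite sqr_enorm.
    exact: ltW.
  rewrite -ler_sqr ?nnegrE ?enorm_ge0 ?mulr_ge0 ?(ltW s0)// sqr_enorm exprMn.
  by rewrite -/(sqdist x y); move: gy2 (q0 y); rewrite /A; nra.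
have uy : u y - u x <= e'.
  have : `|u y - u x| < e'.
    by apply: hd; apply: le_lt_trans sd; apply: le_trans yd; exact: norm_le_enorm.
  by rewrite ltr_norml; lra.
have := hy z; have := phihi z; have := le_trans (enorm_ge0 _) (philo y).
rewrite -/A; move: uy se; rewrite /e'; lra.
Qed.

(** The upper bound on [w] is required everywhere but the lower one only at [x], so that
both suprema of families and uniform limits are covered. Adding the squared distance to
the test function makes the contact strict, hence the contact points of the
approximations converge to [x]. *)
Lemma vsub_stability H (G : V * R -> R) u : continuous H -> continuous G ->
  (forall (x : V) (eta : R), 0 < eta -> exists w : V -> R,
    [/\ continuous w, forall y, w y <= u y + eta, u x - eta <= w x &
        vsub H (fun y => G (y, w y) + eta) w]) ->
  vsub H (fun y => G (y, u y)) u.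
Proof.
move=> Hc Gc happ phi x hphi /near_norm[rho0 [rho00 hx]].
have gc := C1_grad_cont hphi.
pose D (z : V * R) := H (z.1, grad phi z.1 + (2 * 1) *: (z.1 - x)) - G z.
have c1 : continuous (fst : V * R -> V) by move=> z; exact: cvg_fst.
have Dc : continuous D.
  apply: contB => //; apply: (cont_comp _ Hc); apply: contP => //.
  apply: contD; first exact: (cont_comp c1 gc).
  by apply: contZ; [exact: contC | apply: contB => //; exact: contC].
rewrite leNgt; apply/negP => hlt.
pose dl := (H (x, grad phi x) - G (x, u x)) / 2.
have dl0 : 0 < dl by rewrite divr_gt0// subr_gt0.
have Dx : dl < D (x, u x).
  by rewrite /D /= subrr scaler0 addr0 /dl; move: hlt; lra.
have /cvgr_gt/(_ _ Dx) := Dc (x, u x).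
move=> /nbhs_ballP[e /= e0 he].
pose rho := rho0 / 2.
have rho_gt0 : 0 < rho by rewrite divr_gt0.
have e20 : 0 < e / 2 by rewrite divr_gt0.
have [d [d0 hd]] := cont_norm x (C1_cont hphi) e20.
pose m := Num.min rho (Num.min e d).
have m0 : 0 < m by rewrite !lt_min rho_gt0 e0 d0.
pose eta := Num.min (Num.min dl (e / 2)) (m ^+ 2 / 4).
have eta0 : 0 < eta by rewrite !lt_min dl0 e20 divr_gt0// exprn_gt0.
have [e1 e2 e3] : [/\ eta <= dl, eta <= e / 2 & eta <= m ^+ 2 / 4].
  by split; rewrite /eta ?ge_min ?lexx ?orbT.
have [w [wc wu wx ws]] := happ x eta eta0.
have [hD gD] := C1_sqdist 1 x.
have [hpsi gpsi] := C1D hphi hD.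
set psi := (fun y => _) in hpsi gpsi.
have [c [hc cmax]] := @ball_max _ _ (fun y => w y - psi y) x rho
  (contB wc (C1_cont hpsi)) (ltW rho_gt0).
have cx : u c - phi c <= u x - phi x.
  by apply: hx; rewrite (le_lt_trans hc)// /rho; lra.
have := cmax x; rewrite subrr normr0 => /(_ (ltW rho_gt0)).
rewrite /psi sqdistxx mulr0 addr0 mul1r => hcx.
have qc := sqdist_ge c x.
have cm : `|c - x| < m.
  rewrite -ltr_sqr ?nnegrE ?(ltW m0)//; apply: le_lt_trans qc _.
  by have := wu c; have := exprn_gt0 2 m0; lra.
have [m1 m2 m3] : [/\ m <= rho, m <= e & m <= d].
  by split; rewrite /m ?ge_min ?lexx ?orbT.
have phic : `|phi c - phi x| < e / 2 by apply: hd; exact: lt_le_trans m3.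
have : dl < D (c, w c).
  apply: he; split => /=; rewrite -ball_normE /= distrC.
    exact: lt_le_trans m2.
  move: phic; rewrite !ltr_norml => /andP[? ?].
  have := wu c; have := sqr_ge0 `|c - x|; move=> *; apply/andP; split; lra.
have : H (c, grad psi c) <= G (c, w c) + eta.
  apply: ws => //; apply: filterS (near_in_ball (lt_le_trans cm m1)) => y hy.
  exact/cmax/ltW.
rewrite gpsi gD /D /=; lra.
Qed.

Lemma vsup_stability H (G : V * R -> R) u : continuous H -> continuous G ->
  (forall (x : V) (eta : R), 0 < eta -> exists w : V -> R,
    [/\ continuous w, forall y, u y - eta <= w y, w x <= u x + eta &
        vsup H (fun y => G (y, w y) - eta) w]) ->
  vsup H (fun y => G (y, u y)) u.
Proof.
move=> Hc Gc happ; apply/vsupN.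
pose G' (z : V * R) := - G (z.1, - z.2).
have G'c : continuous G'.
  apply: contN; apply: (cont_comp _ Gc); apply: contP.
    by move=> z; exact: cvg_fst.
  by apply: contN => z; exact: cvg_snd.
have -> : (fun x => - G (x, u x)) = (fun x => G' (x, - u x)).
  by apply/funext => x; rewrite /G' /= opprK.
apply: (@vsub_stability _ G' (fun x => - u x) (flipH_cont Hc) G'c) => x eta eta0.
have [w [wc wu wx ws]] := happ x eta eta0; exists (fun y => - w y); split.
- exact: contN.
- by move=> y; have := wu y; lra.
- by move: wx; lra.
- move/vsupN: ws; congr (vsub _ _ _); apply/funext => y.
  by rewrite /G' /= opprK; ring.
Qed.

End Regularity.

(** * Perron's method *)

Section Perron.
Context {R : realType} {n : nat}.
Local Notation V := 'rV[R]_n.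
Implicit Types (x y z a p : V) (H : V * V -> R) (u v f g phi : V -> R).

Lemma C1_shift phi a : Ck unitv 1 phi ->
  Ck unitv 1 (fun x => phi (x + a)) /\
  grad (fun x => phi (x + a)) = (fun x => grad phi (x + a)).
Proof.
move=> hphi.
have sc : continuous (fun x : V => x + a).
  by apply: contD; [exact: cont_id | exact: contC].
apply: C1_intro => [x i||].
- have d := C1_is_derive hphi (x + a) i.
  rewrite -[x + a](add0r) -(scale0r (unitv i)) in d.
  have -> : x = 0 *: unitv i + x by rewrite scale0r add0r.
  apply/is_derive_lineP; move/is_derive_lineP: d.
  rewrite scale0r !add0r.
  by under eq_fun do rewrite addrA.
- exact: (cont_comp sc (C1_cont hphi)).
- exact: (cont_comp sc (C1_grad_cont hphi)).
Qed.

Lemma near_shiftD (P : V -> Prop) x a : (\forall y \near x, P y) ->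
  \forall y \near x + a, P (y - a).
Proof.
move=> /near_norm[e [e0 h]]; apply: (norm_near e0) => y hy; apply: h.
by rewrite -addrA -opprD (addrC a).
Qed.

Lemma near_eq_continuous_at (T : topologicalType) (F G : T -> R) (x : T) :
  (\forall y \near x, F y = G y) -> {for x, continuous G} ->
  {for x, continuous F}.
Proof.
move=> h Gc; rewrite /prop_for/continuous_at (nbhs_singleton h).
by apply: cvg_trans Gc; apply: near_eq_cvg; apply: filterS h => y ->.
Qed.

Lemma cont_max (F G : V -> R) : continuous F -> continuous G ->
  continuous (fun x => Num.max (F x) (G x)).
Proof. by move=> Fc Gc x; apply: continuous_max; [exact: Fc|exact: Gc]. Qed.

(** Maximality step of Perron's method: where a subsolution fails to be a
supersolution it can be raised locally, by the touching function itself. *)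
Lemma perron_bump H f (lam C : R) u phi x0 : continuous H -> continuous f ->
  continuous u -> (forall x, `|u x| <= C) ->
  vsub H (fun x => f x - lam * u x) u -> Ck unitv 1 phi ->
  (\forall y \near x0, u x0 - phi x0 <= u y - phi y) ->
  H (x0, grad phi x0) < f x0 - lam * u x0 -> u x0 < C ->
  exists w, [/\ continuous w, forall x, `|w x| <= C,
    vsub H (fun x => f x - lam * w x) w & u x0 < w x0].
Proof.
move=> Hc fc uc uC usub hphi /near_norm[rho0 [rho00 hx]] hlt uxC.
have d1 : continuous (fst : V * R -> V) by move=> z; exact: cvg_fst.
have d2 : continuous (snd : V * R -> R) by move=> z; exact: cvg_snd.
(* the bump: phi, lowered to make the contact strict, then raised by eta *)
have [hQ gQ] := C1_sqdist (-1) x0.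
have [h1 g1] := C1D hphi hQ.
set psi0 := (fun y => _) in h1 g1.
have p1 : continuous psi0 := C1_cont h1.
pose c0 := u x0 - phi x0.
have c0E : phi x0 + c0 = u x0 by rewrite /c0 addrC subrK.
pose E (z : V * R) := f z.1 - lam * (psi0 z.1 + c0 + z.2) - H (z.1, grad psi0 z.1).
pose E' (z : V * R) := psi0 z.1 + c0 + z.2.
have E'c : continuous E'.
  apply: contD => //; apply: contD; last exact: contC.
  exact: (cont_comp d1 p1).
have Ec : continuous E.
  apply: contB.
    apply: contB; first exact: (cont_comp d1 fc).
    by apply: contM => //; exact: contC.
  apply: (cont_comp _ Hc); apply: contP => //.
  exact: (cont_comp d1 (C1_grad_cont h1)).
have psi0x : psi0 x0 = phi x0 by rewrite /psi0 sqdistxx mulr0 addr0.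
have E0 : 0 < E (x0, 0).
  rewrite /E /= psi0x g1 gQ subrr scaler0 !addr0 c0E.
  by move: hlt; lra.
have E'0 : E' (x0, 0) < C by rewrite /E' /= psi0x addr0 c0E.
have /cvgr_gt/(_ _ E0)/nbhs_ballP[e1 /= e10 he1] := Ec (x0, 0).
have /cvgr_lt/(_ _ E'0)/nbhs_ballP[e2 /= e20 he2] := E'c (x0, 0).
pose e := Num.min rho0 (Num.min e1 e2).
have e0 : 0 < e by rewrite !lt_min rho00 e10 e20.
have [l1 l2 l3] : [/\ e <= rho0, e <= e1 & e <= e2].
  by split; rewrite /e ?ge_min ?lexx ?orbT.
pose eta := Num.min (e / 2) (e ^+ 2 / 8).
have eta0 : 0 < eta by rewrite lt_min !divr_gt0// exprn_gt0.
have [t1 t2] : eta <= e / 2 /\ eta <= e ^+ 2 / 8.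
  by rewrite /eta !ge_min !lexx ?orbT.
have bump y : `|y - x0| < e -> 0 < E (y, eta) /\ E' (y, eta) < C.
  move=> hy; split; [apply: he1 | apply: he2]; split => /=.
  - by rewrite -ball_normE /= distrC; exact: lt_le_trans l2.
  - by rewrite -ball_normE /= sub0r normrN gtr0_norm//; lra.
  - by rewrite -ball_normE /= distrC; exact: lt_le_trans l3.
  - by rewrite -ball_normE /= sub0r normrN gtr0_norm//; lra.
pose psi y := psi0 y + (c0 + eta).
have [hpsi gpsi] : Ck unitv 1 psi /\ grad psi = grad psi0.
  have [q1 q2] := C1_cst (n := n) (c0 + eta); have [q3 q4] := C1D h1 q1.
  by split=> //; rewrite /psi q4 q2; apply/funext => y; rewrite addr0.
have psiE y : psi y = E' (y, eta) by rewrite /psi /E' /= addrA.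
have psilt y : e / 2 <= `|y - x0| -> `|y - x0| < e -> psi y < u y.
  move=> y1 y2; have := hx y (lt_le_trans y2 l1); have := sqdist_ge y x0.
  have : (e / 2) ^+ 2 <= `|y - x0| ^+ 2.
    by rewrite ler_sqr ?nnegrE// divr_ge0// ltW.
  have := exprn_gt0 2 e0.
  by rewrite /psi /psi0 /c0 mulN1r; lra.
pose w y := if `|y - x0| < e then Num.max (u y) (psi y) else u y.
have wu y : u y <= w y.
  by rewrite /w; case: ifP => // _; rewrite le_max lexx.
have wc : continuous w.
  move=> y; have [hy|hy] := ltP `|y - x0| e.
    apply: (@near_eq_continuous_at _ _ (fun y => Num.max (u y) (psi y))); last first.
      exact: (cont_max uc (C1_cont hpsi)).
    by apply: filterS (near_in_ball hy) => y' hy'; rewrite /w hy'.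
  apply: (@near_eq_continuous_at _ _ u); last exact: uc.
  apply: (@norm_near _ _ _ _ (e / 2)); first by rewrite divr_gt0.
  move=> y' hy'; rewrite /w; case: ifP => // hy2.
  apply/max_idPl; apply/ltW/psilt => //.
  have := ler_distD y' y x0; rewrite (distrC y y'); move: hy' hy; lra.
exists w; split=> // [y|chi y hchi hy|]; last 1 first.
  rewrite /w subrr normr0 e0 lt_max; apply/orP; right.
  by rewrite /psi psi0x /c0; lra.
    rewrite ler_norml; apply/andP; split.
      by apply: le_trans (wu y); have := uC y; rewrite ler_norml => /andP[].
    have uyC : u y <= C by have := uC y; rewrite ler_norml => /andP[].
    rewrite /w; case: ifP => // hy; rewrite ge_max uyC /= psiE.
    exact: ltW (bump y hy).2.
  have [wE|wE] := eqVneq (w y) (u y).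
    rewrite wE; apply: usub => //; apply: filterS hy => y'; rewrite wE.
    by have := wu y'; lra.
  move: (wE); rewrite {1}/w; case: ifP => [hye|]; last by rewrite eqxx.
  move=> hm; have wpsi : w y = psi y.
    rewrite /w hye; move: hm; rewrite /Num.max; case: ifP => //.
    by rewrite eqxx.
  have -> : grad chi y = grad psi y.
    apply: grad_touching => //.
    apply: filterS2 (near_in_ball hye) hy => y' hy'; rewrite wpsi.
    have : psi y' <= w y' by rewrite /w hy' le_max lexx orbT.
    by lra.
  have := (bump y hye).1; rewrite /E /= gpsi wpsi psiE /E' /=; lra.
Qed.

(** Perron's method. The supremum is taken over the bounded subsolutions on the whole
space, periodic or not: they are equi-Lipschitz by coercivity, the class is stable under
the local bumps used for maximality, and its invariance under integer translations makes
the supremum periodic. *)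
Lemma perron H f (lam : R) : continuous H ->
  (forall p, Zn_periodic (fun x => H (x, p))) -> coercive H -> 0 < lam ->
  C_torus f ->
  exists u, [/\ C_torus u, vsub H (fun x => f x - lam * u x) u &
                vsup H (fun x => f x - lam * u x) u].
Proof.
move=> Hc Hper Hco lam0 hf.
have [Bf [Bf0 hBf]] := torus_bounded hf.
have H0t : C_torus (fun x => H (x, 0)).
  split; last exact: Hper.
  by apply: (cont_comp _ Hc); apply: contP; [exact: cont_id | exact: contC].
have [B0 [B00 hB0]] := torus_bounded H0t.
(* the constants - C and C are a strict subsolution and a strict supersolution *)
pose C := (B0 + Bf + 1) / lam.
have lC : lam * C = B0 + Bf + 1 by rewrite /C mulrC divfK // gt_eqF.
have C0 : 0 < C by rewrite divr_gt0//; lra.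
pose S (w : V -> R) := [/\ continuous w, forall x, `|w x| <= C &
  vsub H (fun x => f x - lam * w x) w].
have S0 : S (fun _ => - C).
  split; [exact: contC | by move=> x; rewrite normrN ger0_norm // ltW |].
  apply: cst_vsub => x; rewrite mulrN lC opprK.
  by have := hB0 x; have := hBf x; rewrite !ler_norml; lra.
have [r hr] := Hco (Bf + lam * C).
pose L := Num.sqrt n%:R * `|r|.
have L0 : 0 <= L by rewrite mulr_ge0.
have Slip w : S w -> forall x z, w z - w x <= (L + 1) * enorm (z - x).
  case=> wc wC ws; apply: (lipschitz_of_vsub L0 wc wC) => phi x hphi hx /=.
  apply: le_trans (enorm_le_norm _) _; rewrite ler_wpM2l//.
  apply: le_trans (ler_norm r); apply: (hr x).
  apply: le_trans (ws _ _ hphi hx) _.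
  have := hBf x; have := wC x; rewrite !ler_norml => /andP[w1 _] /andP[_ f1].
  have : lam * - C <= lam * w x by rewrite ler_pM2l.
  by rewrite mulrN; lra.
pose A x := [set w x | w in S].
have Asup x : has_sup (A x).
  split; first by exists (- C), (fun _ => - C).
  by exists C => _ [w [_ wC _] <-]; have := wC x; rewrite ler_norml => /andP[].
pose u x := sup (A x).
have uge w x : S w -> w x <= u x.
  by move=> Sw; apply: sup_upper_bound; [exact: Asup | exists w].
have ule x (M : R) : (forall w, S w -> w x <= M) -> u x <= M.
  by move=> h; apply: sup_le_ub; [case: (Asup x) | move=> _ [w Sw <-]; exact: h].
have ulip x z : u z - u x <= (L + 1) * enorm (z - x).
  rewrite lerBlDr; apply: ule => w Sw.
  by have := Slip w Sw x z; have := uge w x Sw; lra.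
have uc : continuous u := lipschitz_cont ulip.
have uC x : `|u x| <= C.
  rewrite ler_norml (uge _ x S0) /=; apply: ule => w [_ wC _].
  by have := wC x; rewrite ler_norml => /andP[].
have Sshift w (k : 'rV[int]_n) : S w -> S (fun x => w (x + map_mx intr k)).
  case=> wc wC ws; split=> //.
    by apply: (cont_comp _ wc); apply: contD; [exact: cont_id | exact: contC].
  move=> phi x hphi hx; set kk := map_mx intr k.
  have [h1 h2] := C1_shift (- kk) hphi.
  have := ws _ (x + kk) h1; rewrite h2 addrK (Hper _ x k) hf.2; apply.
  by apply: filterS (near_shiftD kk hx) => y; rewrite subrK.
have uper : Zn_periodic u.
  have h x k : u (x + map_mx intr k) <= u x.
    by apply: ule => w Sw; exact: (uge _ x (Sshift w k Sw)).
  move=> x k; apply/eqP; rewrite eq_le h /=.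
  have := h (x + map_mx intr k) (- k).
  suff -> : x + map_mx intr k + map_mx intr (- k) = x by [].
  by apply/rowP => i; rewrite !mxE mulrNz addrK.
pose G (z : V * R) := f z.1 - lam * z.2.
have d1 : continuous (fst : V * R -> V) by move=> z; exact: cvg_fst.
have d2 : continuous (snd : V * R -> R) by move=> z; exact: cvg_snd.
have Gc : continuous G.
  apply: contB; first exact: (cont_comp d1 hf.1).
  by apply: contM => //; exact: contC.
have usub : vsub H (fun x => f x - lam * u x) u.
  apply: (@vsub_stability _ _ H G u Hc Gc) => x eta eta0.
  have [_ [w Sw <-] hw] := sup_adherent eta0 (Asup x).
  exists w; case: (Sw) => wc wC ws; split=> //.
  - by move=> y; have := uge w y Sw; lra.
  - exact: ltW.
  - by move=> phi y hphi hy; have := ws phi y hphi hy; rewrite /G /=; lra.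
exists u; split=> // phi x0 hphi hx0; rewrite leNgt; apply/negP => hlt.
(* otherwise phi has a local maximum at x0, against the choice of C *)
have uxC : u x0 < C.
  have := uC x0; rewrite ler_norml => /andP[_]; rewrite le_eqVlt => /orP[/eqP uE|//].
  exfalso; have g0 : grad phi x0 = 0.
    apply: grad_local_max => //; apply: filterS hx0 => y; rewrite uE.
    by have := uC y; rewrite ler_norml; lra.
  move: hlt; rewrite g0 uE lC; have := hB0 x0; have := hBf x0.
  by rewrite !ler_norml; lra.
have [w [wc wC ws hw]] := perron_bump Hc hf.1 uc uC usub hphi hx0 hlt uxC.
by have := uge w x0 (And3 wc wC ws); rewrite leNgt hw.
Qed.

End Perron.

(** * The discounted system *)

Section Discounted.
Context {R : realType} {n : nat}.
Local Notation V := 'rV[R]_n.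
Implicit Types (x y z a p : V) (H : V * V -> R) (u v f g : V -> R).

(** As in [vsub], terms of order zero belong to [g]. *)
Definition vsol H g u : Prop := [/\ C_torus u, vsub H g u & vsup H g u].

Definition torus_hamiltonian H : Prop :=
  continuous H /\ forall p, Zn_periodic (fun x => H (x, p)).

Definition coercive_up_to_sign H : Prop := coercive H \/ coercive (flipH H).

Lemma scalar_existence H f (lam : R) : torus_hamiltonian H ->
  coercive_up_to_sign H -> 0 < lam -> C_torus f ->
  exists u, vsol H (fun x => f x - lam * u x) u.
Proof.
move=> [Hc Hp] [Hco|Hco] lam0 hf.
  by have [u [h1 h2 h3]] := perron Hc Hp Hco lam0 hf; exists u.
have [|u [h1 h2 h3]] := perron (flipH_cont Hc) _ Hco lam0 (C_torusN hf).
  by move=> p x k; rewrite /flipH /= (Hp (- p)).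
have E : (fun x => - f x - lam * u x) = (fun x => - (f x - lam * - u x)).
  by apply/funext => x; ring.
have Eu : u = (fun x => - - u x) by apply/funext => x; rewrite opprK.
exists (fun x => - u x); split; first exact: C_torusN.
- by apply/vsubN; rewrite -E -Eu.
- by apply/vsupN; rewrite -E -Eu.
Qed.

(** Comparison in both directions: the solution operator is [1 / lam]-Lipschitz. *)
Lemma scalar_contraction H f g u v (lam M : R) : continuous H ->
  coercive_up_to_sign H -> 0 < lam -> C_torus f -> C_torus g ->
  vsol H (fun x => f x - lam * u x) u -> vsol H (fun x => g x - lam * v x) v ->
  (forall x, `|f x - g x| <= M) -> forall x, `|u x - v x| <= M / lam.
Proof.
move=> Hc Hco lam0 hf hg [hu su pu] [hv sv pv] hM x.
have key f' g' u' v' : C_torus f' -> C_torus g' -> C_torus u' -> C_torus v' ->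
    vsub H (fun x => f' x - lam * u' x) u' ->
    vsup H (fun x => g' x - lam * v' x) v' ->
    (forall x, f' x - g' x <= M) -> u' x - v' x <= M / lam.
  move=> hf' hg' hu' hv' s p hfg.
  have hT w q : C_torus w -> C_torus q -> C_torus (fun x => w x - lam * q x).
    by move=> hw hq; apply: C_torusD => //; apply/C_torusN/C_torusZ.
  have [xh [h1 h2]] := comparison Hc Hco (hT _ _ hf' hu') (hT _ _ hg' hv') hu' hv' s p.
  apply: le_trans (h1 x) _; rewrite ler_pdivlMr// mulrC mulrBr.
  by have := hfg xh; lra.
rewrite ler_norml; apply/andP; split.
  rewrite lerNl opprB; apply: (key g f) => // y.
  by have := hM y; rewrite ler_norml; lra.
by apply: (key f g) => // y; have := hM y; rewrite ler_norml; lra.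
Qed.

(** Solving the two scalar equations in turn contracts the second component by the
factor [c1 / (c1 + delta)]; the discounted system is thus solved up to any error. *)
Lemma discounted_pair H1 H2 (c1 c2 delta eta : R) :
  torus_hamiltonian H1 -> torus_hamiltonian H2 ->
  coercive_up_to_sign H1 -> coercive_up_to_sign H2 ->
  0 < c1 -> 0 < c2 -> 0 < delta -> 0 < eta ->
  exists v u1 u2, [/\ vsol H1 (fun x => c1 * v x - (c1 + delta) * u1 x) u1,
    vsol H2 (fun x => c2 * u1 x - (c2 + delta) * u2 x) u2 &
    forall x, `|u2 x - v x| <= eta].
Proof.
move=> h1 h2 co1 co2 c10 c20 d0 eta0.
have l10 : 0 < c1 + delta by lra.
have l20 : 0 < c2 + delta by lra.
pose th := c1 / (c1 + delta).
have th0 : 0 <= th by rewrite divr_ge0// ltW.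
have th1 : th < 1 by rewrite ltr_pdivrMr//; lra.
have step1 v : C_torus v ->
    exists u1, vsol H1 (fun x => c1 * v x - (c1 + delta) * u1 x) u1.
  by move=> hv; apply: scalar_existence => //; exact: C_torusZ.
have step2 v : C_torus v ->
    exists u1, vsol H2 (fun x => c2 * v x - (c2 + delta) * u1 x) u1.
  by move=> hv; apply: scalar_existence => //; exact: C_torusZ.
have [D hD] : exists D : R, forall k, exists v u1 u2, [/\ C_torus v,
    vsol H1 (fun x => c1 * v x - (c1 + delta) * u1 x) u1,
    vsol H2 (fun x => c2 * u1 x - (c2 + delta) * u2 x) u2 &
    forall x, `|u2 x - v x| <= D * th ^+ k].
  have hv := C_torusC (0 : R) (n := n).
  have [u1 s1] := step1 _ hv; have [u1T _ _] := s1.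
  have [u2 s2] := step2 _ u1T; have [u2T _ _] := s2.
  have [D [D0 hD]] := torus_bounded u2T.
  exists D; elim=> [|k [v [w1 [w2 [hv' t1 t2 hk]]]]].
    exists (fun _ => 0), u1, u2; split=> // x.
    by rewrite subr0 expr0 mulr1.
  have [w2T _ _] := t2; have [w1' t1'] := step1 _ w2T; have [w1T' _ _] := t1'.
  have [w2' t2'] := step2 _ w1T'; exists w2, w1', w2'; split=> // x.
  have [w1T _ _] := t1.
  have e1 y : `|w1' y - w1 y| <= c1 * (D * th ^+ k) / (c1 + delta).
    apply: (scalar_contraction (H := H1) (f := fun x => c1 * w2 x)
      (g := fun x => c1 * v x)) => //; [exact: h1.1|exact: C_torusZ|exact: C_torusZ|].
    by move=> z; rewrite -mulrBr normrM gtr0_norm// ler_pM2l.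
  have e2 : `|w2' x - w2 x| <= c2 * (c1 * (D * th ^+ k) / (c1 + delta)) / (c2 + delta).
    apply: (scalar_contraction (H := H2) (f := fun x => c2 * w1' x)
      (g := fun x => c2 * w1 x)) => //; [exact: h2.1|exact: C_torusZ|exact: C_torusZ|].
    by move=> z; rewrite -mulrBr normrM gtr0_norm// ler_pM2l.
  apply: le_trans e2 _; rewrite ler_pdivrMr//.
  have -> : c1 * (D * th ^+ k) / (c1 + delta) = D * th ^+ k.+1.
    by rewrite exprS /th; ring.
  rewrite [leRHS]mulrC ler_wpM2r ?mulr_ge0 ?exprn_ge0 ?(ltW D0)//; lra.
have thn : `|th| < 1 by rewrite ger0_norm.
have : (fun k => D * th ^+ k) @ \oo --> D * 0.
  by apply: cvgM; [exact: cvg_cst | exact: cvg_expr].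
rewrite mulr0 => /cvgr_lt/(_ _ eta0)/filter_ex[k hk].
have [v [u1 [u2 [_ s1 s2 hv]]]] := hD k.
by exists v, u1, u2; split=> // x; apply: le_trans (hv x) _; exact: ltW.
Qed.

End Discounted.

(** * A priori bounds *)

Section Apriori.
Context {R : realType} {n : nat}.
Local Notation V := 'rV[R]_n.
Implicit Types (x y z a p : V) (H : V * V -> R) (u v w f g : V -> R).

(** The slope is the one forced by the growth condition,
[16 n c ^ 2 = (4 sqrt n c) ^ 2]. *)
Definition steep H (c : R) : Prop := exists r : R, forall x p, r < enorm p ->
  4 * Num.sqrt n%:R * c * enorm p <= H (x, p).

(** Exchanging [x] and [z] gives the two-sided estimate. *)
Definition lip (K : R) u : Prop := forall x z, u z - u x <= K * enorm (z - x).

Lemma lipN (K : R) u : lip K u -> lip K (fun x => - u x).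
Proof.
move=> h x z; have := h z x; rewrite -enormN opprB; lra.
Qed.

Lemma steep_coercive H (c : R) : (0 < n)%N -> 0 < c -> steep H c -> coercive H.
Proof.
move=> n0 c0 [r hr] C; pose k := 4 * Num.sqrt n%:R * c.
have k0 : 0 < k by rewrite !mulr_gt0// sqrtr_gt0 ltr0n.
exists (Num.max r (C / k)) => x p hC; apply: le_trans (norm_le_enorm p) _.
rewrite le_max; have [//|hp] := leP (enorm p) r.
by rewrite ler_pdivlMr// mulrC (le_trans (hr x p hp)).
Qed.

Lemma lip_osc (K : R) u : Zn_periodic u -> 0 <= K -> lip K u ->
  forall x y, u x - u y <= K * Num.sqrt n%:R.
Proof.
move=> up K0 hu x y; have [k hk] := unit_translate x y.
rewrite -(up x k); apply: le_trans (hu _ _) _; rewrite ler_wpM2l//.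
apply: le_trans (enorm_le_norm _) _; rewrite -[leRHS]mulr1.
by rewrite ler_wpM2l ?sqrtr_ge0.
Qed.

(** The slope [4 sqrt n c] absorbs the oscillation: on the unit torus a Lipschitz
constant [L] only allows an oscillation [sqrt n * L], so a right-hand side growing
like [c] times the oscillation gives [L <= L / 4 + const]. The oscillation enters
through pairs of values, a form that is symmetric under [u |-> - u]. *)
Lemma lip_apriori_sub H (c C : R) : (0 < n)%N -> 0 < c -> steep H c ->
  exists K : R, 0 <= K /\ forall u g, C_torus u -> vsub H g u ->
    (forall x, exists y z, g x <= c * (u y - u z) + C) -> lip K u.
Proof.
move=> n0 c0 [r hr]; pose s := Num.sqrt n%:R : R.
have s0 : 0 < s by rewrite sqrtr_gt0 ltr0n.
(* wherever the gradient exceeds r, steepness bounds it by o / (4 s) up to E *)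
pose E := `|r| + `|C| / (4 * s * c).
have E0 : 0 <= E by rewrite addr_ge0// divr_ge0// !mulr_ge0// ltW.
exists (2 * (E + 1)); split; first by lra.
move=> u g hu su hg; have [xM hM] := torus_max hu; have [xm hm] := torus_min hu.
pose o := u xM - u xm; have o0 : 0 <= o by rewrite subr_ge0.
pose L := E + o / (4 * s).
have k0 : 0 < 4 * s * c by rewrite !mulr_gt0.
have os0 : 0 <= o / (4 * s) by rewrite divr_ge0// mulr_ge0// ltW.
have L0 : 0 <= L by rewrite addr_ge0.
have [B [_ uB]] := torus_bounded hu.
have hL : lip (L + 1) u.
  apply: (lipschitz_of_vsub L0 hu.1 uB) => phi x hphi hx /=.
  have [hp|hp] := leP (enorm (grad phi x)) r.
    apply: le_trans hp _; rewrite /L /E; have := ler_norm r.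
    have : 0 <= `|C| / (4 * s * c) by rewrite divr_ge0// ltW.
    lra.
  have h1 := le_trans (hr x _ hp) (su _ _ hphi hx).
  have [y [z hyz]] := hg x.
  have h2 : 4 * s * c * enorm (grad phi x) <= c * o + `|C|.
    apply: le_trans h1 (le_trans hyz _); apply: lerD; last exact: ler_norm.
    by rewrite ler_pM2l// /o; have := hM y; have := hm z; lra.
  have h3 : enorm (grad phi x) <= (c * o + `|C|) / (4 * s * c).
    by rewrite ler_pdivlMr// mulrC.
  apply: le_trans h3 _; rewrite mulrDl /L /E.
  have -> : c * o / (4 * s * c) = o / (4 * s).
    field; by rewrite !gt_eqF.
  by have := normr_ge0 r; lra.
have ho : o <= (L + 1) * s by apply: (lip_osc hu.2 _ hL); lra.
have hLL : o / (4 * s) <= (L + 1) / 4.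
  rewrite ler_pdivrMr ?mulr_gt0//; apply: le_trans ho _.
  by rewrite mulrA divfK// mulrC.
move=> x z; apply: le_trans (hL x z) _; rewrite ler_wpM2r ?enorm_ge0//.
by move: hLL; rewrite /L; lra.
Qed.

Definition steep_up_to_sign H (c : R) : Prop := steep H c \/ steep (flipH H) c.

Lemma lip_apriori H (c C : R) : (0 < n)%N -> 0 < c -> steep_up_to_sign H c ->
  exists K : R, 0 <= K /\ forall u g, vsol H g u ->
    (forall x, exists y z, `|g x| <= c * (u y - u z) + C) -> lip K u.
Proof.
move=> n0 c0 [st|st]; have [K [K0 hK]] := lip_apriori_sub C n0 c0 st;
  exists K; split=> // u g [hu su pu] hg.
  apply: (hK u g) => // x; have [y [z h]] := hg x; exists y, z.
  exact: le_trans (ler_norm _) h.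
have -> : u = (fun x => - - u x) by apply/funext => x; rewrite opprK.
apply: lipN; apply: (hK _ (fun x => - g x)) (C_torusN hu) _ _.
  exact/vsupN.
move=> x; have [y [z h]] := hg x; exists z, y.
by rewrite opprK (addrC (- u z)); apply: le_trans h; rewrite -normrN ler_norm.
Qed.

(** Evaluating the two equations at the extrema of the components: the discounted
terms are bounded, and the components have close maxima and close minima. *)
Lemma extrema_bounds (c1 c2 d eta C0 M1 M2 m1 m2 : R) :
  0 < c1 -> 0 < c2 -> 0 < d -> 0 <= eta -> eta <= 1 -> 0 <= C0 ->
  m1 <= M1 -> m2 <= M2 ->
  - C0 <= c1 * (M2 + eta) - (c1 + d) * M1 -> - C0 <= c2 * M1 - (c2 + d) * M2 ->
  c1 * (m2 - eta) - (c1 + d) * m1 <= C0 -> c2 * m1 - (c2 + d) * m2 <= C0 ->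
  let C1 := C0 + c1 in
  [/\ d * M1 <= C1 /\ d * M2 <= C1, - C1 <= d * m1 /\ - C1 <= d * m2,
      c1 * `|M1 - M2| <= 2 * C1 + 2 * c1 / c2 * C1 &
      c1 * `|m1 - m2| <= 2 * C1 + 2 * c1 / c2 * C1].
Proof.
move=> c10 c20 d0 eta0 eta1 C00 hM1 hM2 q1 q2 q3 q4 C1.
have ce : c1 * eta <= c1 by rewrite -[leRHS]mulr1 ler_wpM2l// ltW.
have C10 : 0 <= C1 by rewrite /C1; lra.
have A : d * M1 <= C1 /\ d * M2 <= C1.
  have [h|h] := leP M1 M2.
    have a : d * M2 <= C1 by rewrite /C1; nra.
    by split=> //; apply: le_trans a; rewrite ler_pM2l.
  have a : d * M1 <= C1 by rewrite /C1; nra.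
  by split=> //; apply: le_trans a; rewrite ler_pM2l// ltW.
have B : - C1 <= d * m1 /\ - C1 <= d * m2.
  have [h|h] := leP m2 m1.
    have a : - C1 <= d * m2 by rewrite /C1; nra.
    by split=> //; apply: le_trans a _; rewrite ler_pM2l.
  have a : - C1 <= d * m1 by rewrite /C1; nra.
  by split=> //; apply: le_trans a _; rewrite ler_pM2l// ltW.
have dm1 : d * m1 <= d * M1 by rewrite ler_pM2l.
have dm2 : d * m2 <= d * M2 by rewrite ler_pM2l.
have [A1 A2] := A; have [B1 B2] := B.
have r1 : c1 * (M1 - M2) <= 2 * C1 by rewrite /C1; rewrite /C1 in B1; lra.
have r2 : c2 * (M2 - M1) <= 2 * C1 by rewrite /C1; rewrite /C1 in B2; lra.
have r3 : c1 * (m2 - m1) <= 2 * C1 by rewrite /C1; rewrite /C1 in A1; lra.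
have r4 : c2 * (m1 - m2) <= 2 * C1 by rewrite /C1; rewrite /C1 in A2; lra.
have conv (t : R) : c2 * t <= 2 * C1 -> c1 * t <= 2 * c1 / c2 * C1.
  move=> h; have -> : c1 * t = c1 / c2 * (c2 * t) by field; rewrite gt_eqF.
  have -> : 2 * c1 / c2 * C1 = c1 / c2 * (2 * C1) by ring.
  by rewrite ler_wpM2l// divr_ge0// ltW.
have x0 : 0 <= 2 * c1 / c2 * C1 by rewrite mulr_ge0// divr_ge0 ?mulr_ge0// ltW.
have fin (a b : R) : c1 * (a - b) <= 2 * C1 + 2 * c1 / c2 * C1 ->
    c1 * (b - a) <= 2 * C1 + 2 * c1 / c2 * C1 ->
    c1 * `|a - b| <= 2 * C1 + 2 * c1 / c2 * C1.
  move=> f1 f2; have [h|h] := leP 0 (a - b); first by rewrite ger0_norm.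
  by rewrite ltr0_norm// opprB.
split=> //; apply: fin.
- by lra.
- by have := conv _ r2; lra.
- by have := conv _ r4; lra.
- by lra.
Qed.

End Apriori.

(** * Passage to the ergodic limit *)

Section Ergodic.
Context {R : realType} {n : nat}.
Local Notation V := 'rV[R]_n.
Implicit Types (x y z a p : V) (H : V * V -> R) (u v w f g : V -> R).

Lemma lip_le (K K' : R) u : K <= K' -> lip K u -> lip K' u.
Proof.
by move=> KK' h x z; apply: le_trans (h x z) _; rewrite ler_wpM2r ?enorm_ge0.
Qed.

Lemma vsol_shift H g u (c : R) : vsol H g u -> vsol H g (fun x => u x - c).
Proof.
case=> hu su pu; split; [|exact: vsub_shift|exact: vsup_shift].
by apply: C_torusD => //; exact: C_torusC.
Qed.

Lemma steep_up_to_sign_coercive H (c : R) : (0 < n)%N -> 0 < c ->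
  steep_up_to_sign H c -> coercive_up_to_sign H.
Proof.
by move=> n0 c0 [] st; [left|right]; exact: (steep_coercive n0 c0 st).
Qed.

Lemma bounded_at_zero_momentum H : torus_hamiltonian H ->
  exists C : R, 0 <= C /\ forall x, - C <= H (x, 0) /\ H (x, 0) <= C.
Proof.
move=> [Hc Hp]; have H0t : C_torus (fun x => H (x, 0)).
  split; last exact: Hp.
  by apply: (cont_comp _ Hc); apply: contP; [exact: cont_id | exact: contC].
have [B [B0 hB]] := torus_bounded H0t; exists B; split; first exact: ltW.
by move=> x; apply/andP; rewrite -ler_norml.
Qed.

Lemma dist_le_osc (a b M1 m1 M2 m2 Q : R) : a <= M1 -> m1 <= a -> b <= M2 ->
  m2 <= b -> `|M1 - M2| <= Q -> `|m1 - m2| <= Q -> `|b - a| <= M1 - m1 + Q.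
Proof.
move=> aM ma bM mb; rewrite !ler_norml => /andP[? ?] /andP[? ?].
by apply/andP; split; lra.
Qed.

(** Normalised solutions of the discounted system solve the ergodic system up to
[O(delta)], with bounds independent of [delta]; the same constant
[h = - delta * u1 0] appears in both equations. *)
Lemma approximate_ergodic H1 H2 (c1 c2 : R) : (0 < n)%N -> 0 < c1 -> 0 < c2 ->
  torus_hamiltonian H1 -> torus_hamiltonian H2 ->
  steep_up_to_sign H1 c1 -> steep_up_to_sign H2 c2 ->
  exists K B : R, [/\ 0 <= K, 0 <= B & forall d : R, 0 < d -> d <= 1 ->
    exists w1 w2 g1 g2 (h : R),
    [/\ vsol H1 g1 w1 /\ vsol H2 g2 w2, lip K w1 /\ lip K w2,
        [/\ forall x, `|w1 x| <= B, forall x, `|w2 x| <= B & `|h| <= B],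
        forall x, `|g1 x - (h - c1 * (w1 x - w2 x))| <= B * d &
        forall x, `|g2 x - (h - c2 * (w2 x - w1 x))| <= B * d]].
Proof.
move=> n0 c10 c20 t1 t2 st1 st2.
have [Ca [Ca0 hCa]] := bounded_at_zero_momentum t1.
have [Cb [Cb0 hCb]] := bounded_at_zero_momentum t2.
pose C0 := Ca + Cb; have C00 : 0 <= C0 by rewrite addr_ge0.
pose C1 := C0 + c1; have C10 : 0 <= C1 by rewrite addr_ge0// ltW.
pose Q := (2 * C1 + 2 * c1 / c2 * C1) / c1.
have Q0 : 0 <= Q.
  by rewrite divr_ge0 ?addr_ge0 ?mulr_ge0 ?divr_ge0 ?(ltW c10) ?(ltW c20)// invr_ge0 ltW.
have [K1 [K10 hK1]] := lip_apriori (c1 * Q + c1 + C1) n0 c10 st1.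
have [K2 [K20 hK2]] := lip_apriori (c2 * Q + C1) n0 c20 st2.
pose K := K1 + K2; pose s := Num.sqrt n%:R : R.
have s0 : 0 <= s by exact: sqrtr_ge0.
have K0 : 0 <= K by rewrite addr_ge0.
have Ks0 : 0 <= K * s by rewrite mulr_ge0.
pose B := 2 * (K * s) + Q + C1 + c1.
have B0 : 0 <= B by rewrite /B; lra.
exists K, B; split=> // d d0 d1.
have [v [u1 [u2 [s1 s2 hv]]]] := discounted_pair t1 t2
  (steep_up_to_sign_coercive n0 c10 st1) (steep_up_to_sign_coercive n0 c20 st2)
  c10 c20 d0 d0.
have [T1 sub1 sup1] := s1; have [T2 sub2 sup2] := s2.
have [X1 hX1] := torus_max T1; have [x1 hx1] := torus_min T1.
have [X2 hX2] := torus_max T2; have [x2 hx2] := torus_min T2.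
have vb y : u2 y - d <= v y /\ v y <= u2 y + d.
  by have := hv y; rewrite ler_norml => /andP[? ?]; split; lra.
have [] := @extrema_bounds R c1 c2 d d C0 (u1 X1) (u2 X2) (u1 x1) (u2 x2)
  c10 c20 d0 (ltW d0) d1 C00 (hX1 x1) (hX2 x2).
- have := vsub_at_max sub1 hX1; have := (hCa X1).1.
  have : c1 * v X1 <= c1 * (u2 X2 + d).
    by rewrite ler_pM2l//; have := (vb X1).2; have := hX2 X1; lra.
  rewrite /C0; lra.
- have := vsub_at_max sub2 hX2; have := (hCb X2).1.
  have : c2 * u1 X2 <= c2 * u1 X1 by rewrite ler_pM2l.
  rewrite /C0; lra.
- have := vsup_at_min sup1 hx1; have := (hCa x1).2.
  have : c1 * (u2 x2 - d) <= c1 * v x1.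
    by rewrite ler_pM2l//; have := (vb x1).1; have := hx2 x1; lra.
  rewrite /C0; lra.
- have := vsup_at_min sup2 hx2; have := (hCb x2).2.
  have : c2 * u1 x1 <= c2 * u1 x2 by rewrite ler_pM2l.
  rewrite /C0; lra.
rewrite -/C1 => -[dM1 dM2] [dm1 dm2].
rewrite mulrC -ler_pdivlMr// -/Q => hM; rewrite mulrC -ler_pdivlMr// -/Q => hm.
have du (w : V -> R) x X y : w x <= w y -> w y <= w X -> d * w X <= C1 ->
    - C1 <= d * w x -> `|d * w y| <= C1.
  move=> q1 q2 q3 q4; rewrite ler_norml; apply/andP; split.
    by apply: le_trans q4 _; rewrite ler_pM2l.
  by apply: le_trans q3; rewrite ler_pM2l.
have du1 y : `|d * u1 y| <= C1 by exact: (du u1 x1 X1).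
have du2 y : `|d * u2 y| <= C1 by exact: (du u2 x2 X2).
have diff1 y : `|u2 y - u1 y| <= u1 X1 - u1 x1 + Q.
  exact: (dist_le_osc (hX1 y) (hx1 y) (hX2 y) (hx2 y) hM hm).
have diff2 y : `|u2 y - u1 y| <= u2 X2 - u2 x2 + Q.
  rewrite distrC; apply: (dist_le_osc (hX2 y) (hx2 y) (hX1 y) (hx1 y));
    by rewrite distrC.
have l1 : lip K u1.
  apply: (@lip_le K1); first by rewrite lerDl.
  apply: (hK1 _ _ s1) => y; exists X1, x1.
  have -> : c1 * v y - (c1 + d) * u1 y =
      c1 * (v y - u2 y) + c1 * (u2 y - u1 y) - d * u1 y by ring.
  apply: le_trans (ler_normB _ _) _; have := du1 y.
  have := ler_normD (c1 * (v y - u2 y)) (c1 * (u2 y - u1 y)).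
  rewrite !(normrM c1) (gtr0_norm c10).
  have : c1 * `|v y - u2 y| <= c1 * 1.
    by rewrite ler_pM2l// distrC; apply: le_trans d1.
  have : c1 * `|u2 y - u1 y| <= c1 * (u1 X1 - u1 x1 + Q) by rewrite ler_pM2l.
  lra.
have l2 : lip K u2.
  apply: (@lip_le K2); first by rewrite lerDr.
  apply: (hK2 _ _ s2) => y; exists X2, x2.
  have -> : c2 * u1 y - (c2 + d) * u2 y = c2 * (u1 y - u2 y) - d * u2 y by ring.
  apply: le_trans (ler_normB _ _) _; have := du2 y.
  rewrite (normrM c2) (gtr0_norm c20).
  have : c2 * `|u1 y - u2 y| <= c2 * (u2 X2 - u2 x2 + Q).
    by rewrite ler_pM2l// distrC.
  lra.
pose a := u1 0; exists (fun x => u1 x - a), (fun x => u2 x - a).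
exists (fun x => c1 * v x - (c1 + d) * u1 x), (fun x => c2 * u1 x - (c2 + d) * u2 x).
exists (- (d * a)).
have o1 x y : u1 x - u1 y <= K * s := lip_osc T1.2 K0 l1 x y.
have w1B x : `|u1 x - a| <= K * s.
  by rewrite ler_norml; have := o1 x 0; have := o1 0 x; rewrite -/a; lra.
have w2B x : `|u2 x - a| <= 2 * (K * s) + Q.
  have -> : u2 x - a = (u2 x - u1 x) + (u1 x - a) by ring.
  apply: le_trans (ler_normD _ _) _; have := w1B x; have := diff1 x.
  by have := o1 X1 x1; lra.
have dn (w b : R) : `|w| <= b -> `|d * w| <= b * d.
  by move=> hb; rewrite normrM gtr0_norm// mulrC ler_pM2r.
split.
- by split; exact: vsol_shift.
- by split=> x z; rewrite opprB addrA subrK; [exact: l1|exact: l2].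
- split=> [x|x|].
  + by apply: le_trans (w1B x) _; rewrite /B; lra.
  + by apply: le_trans (w2B x) _; rewrite /B; lra.
  + by rewrite normrN; apply: le_trans (du1 0) _; rewrite /B; lra.
- move=> x.
  have -> : c1 * v x - (c1 + d) * u1 x -
      (- (d * a) - c1 * (u1 x - a - (u2 x - a))) =
      c1 * (v x - u2 x) - d * (u1 x - a) by ring.
  apply: le_trans (ler_normB _ _) _; have := dn _ _ (w1B x).
  rewrite (normrM c1) (gtr0_norm c10).
  have : c1 * `|v x - u2 x| <= c1 * d by rewrite ler_pM2l// distrC.
  have : (K * s + c1) * d <= B * d by rewrite ler_pM2r// /B; lra.
  lra.
- move=> x.
  have -> : c2 * u1 x - (c2 + d) * u2 x -
      (- (d * a) - c2 * (u2 x - a - (u1 x - a))) = - (d * (u2 x - a)) by ring.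
  rewrite normrN; apply: le_trans (dn _ _ (w2B x)) _.
  by rewrite ler_pM2r// /B; lra.
Qed.

End Ergodic.

Section Limit.
Context {R : realType} {n : nat} {U : set_system nat} {UU : UltraFilter U}.
Local Notation V := 'rV[R]_n.
Implicit Types (x y z a p : V) (H : V * V -> R) (u v w f g : V -> R).

(** For equi-Lipschitz periodic functions pointwise convergence along an
ultrafilter is uniform: points of almost maximal error converge as well. *)
Lemma ultra_uniform (w_ : nat -> V -> R) (K B : R) : 0 <= K ->
  (forall k, C_torus (w_ k)) -> (forall k, lip K (w_ k)) ->
  (forall k x, `|w_ k x| <= B) ->
  exists w, [/\ C_torus w, lip K w & forall e : R, 0 < e ->
    \forall k \near U, forall x, `|w_ k x - w x| <= e].
Proof.
move=> K0 wT wl wB.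
have /choice[w hw] : forall x, exists l : R, (fun k => w_ k x) @ U --> l.
  by move=> x; apply: (@ultra_lim _ _ _ _ B).
have wlip : lip K w.
  move=> x z; apply: (@ultra_le _ U _ (fun k => w_ k z - w_ k x)
    (fun _ => K * enorm (z - x))); last by move=> k; exact: wl.
  - exact: (cvgB (hw z) (hw x)).
  - exact: cvg_cst.
have wper : Zn_periodic w.
  move=> x k; apply: (cvg_unique _ (hw _)) => //.
  have -> : (fun j => w_ j (x + map_mx intr k)) = (fun j => w_ j x).
    by apply/funext => j; rewrite (wT j).2.
  exact: hw.
exists w; split=> //; first by split=> //; exact: lipschitz_cont wlip.
move=> e e0.
have /choice[z hz] : forall k, exists x : V, `|x| <= 1 /\
    ((exists y, e < `|w_ k y - w y|) -> e < `|w_ k x - w x|).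
  move=> k; have [[y hy]|no] := pselect (exists y, e < `|w_ k y - w y|).
    have [j hj] := unit_translate y 0; exists (y + map_mx intr j).
    by move: hj; rewrite subr0 (wT k).2 wper.
  by exists 0; rewrite normr0; split=> // /no.
have [zl hzl] : exists l : V, z @ U --> l.
  by apply: (@ultra_lim_rV _ _ _ _ _ 1) => k; exact: (hz k).1.
have e3 : 0 < e / 3 by rewrite divr_gt0.
have C : 0 < e / 3 / (K * Num.sqrt n%:R + 1).
  by rewrite divr_gt0// ltr_wpDl// mulr_ge0.
have n1 : \forall k \near U, `|w_ k zl - w zl| < e / 3.
  have /cvgrPdist_lt/(_ _ e3) := hw zl.
  by apply: filterS => k; rewrite distrC.
have n2 : \forall k \near U, `|zl - z k| < e / 3 / (K * Num.sqrt n%:R + 1).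
  by have /cvgrPdist_lt/(_ _ C) := hzl.
apply: filterS2 n1 n2 => k k1 k2 x; rewrite leNgt; apply/negP => bad.
have [_ /(_ _)] := hz k; move=> /(_ (ex_intro _ x bad)).
have D a b : K * enorm (a - b) <= (K * Num.sqrt n%:R + 1) * `|b - a|.
  rewrite mulrDl mul1r -mulrA distrC.
  have : K * enorm (a - b) <= K * (Num.sqrt n%:R * `|a - b|).
    by rewrite ler_wpM2l// enorm_le_norm.
  by have := normr_ge0 (a - b); lra.
move: k2; rewrite ltr_pdivlMr ?ltr_wpDl ?mulr_ge0// mulrC => k2.
have := D (z k) zl; have := D zl (z k); rewrite (distrC (z k) zl).
have := wl k zl (z k); have := wl k (z k) zl.
have := wlip zl (z k); have := wlip (z k) zl.
move: k1; rewrite ltr_norml => /andP[? ?] *.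
suff : `|w_ k (z k) - w (z k)| <= e by lra.
by rewrite ler_norml; apply/andP; split; lra.
Qed.

(** The right-hand side depends on the unknown [wk] itself, so it is replaced by a
function [G] of the point and the value, at the price of an error of order [eta]. *)
Lemma vsol_limit H (c h : R) w w' : continuous H -> 0 < c -> C_torus w ->
  C_torus w' ->
  (forall eta : R, 0 < eta -> exists wk wk' gk hk,
    [/\ vsol H gk wk, forall x, `|wk x - w x| <= eta,
        forall x, `|wk' x - w' x| <= eta, `|hk - h| <= eta &
        forall x, `|gk x - (hk - c * (wk x - wk' x))| <= eta]) ->
  vsol H (fun x => h - c * (w x - w' x)) w.
Proof.
move=> Hc c0 wT wT' happ.
pose G (z : V * R) := h - c * (z.2 - w' z.1).
have d1 : continuous (fst : V * R -> V) by move=> z; exact: cvg_fst.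
have d2 : continuous (snd : V * R -> R) by move=> z; exact: cvg_snd.
have Gc : continuous G.
  apply: contB; first exact: contC.
  apply: contM; first exact: contC.
  by apply: contB => //; exact: (cont_comp d1 wT'.1).
have approx (eta : R) : 0 < eta -> exists wk gk, [/\ vsol H gk wk,
    forall x, `|wk x - w x| <= eta & forall x, `|gk x - G (x, wk x)| <= eta].
  move=> eta0; have e0 : 0 < eta / (2 + c) by rewrite divr_gt0// addr_gt0.
  have [wk [wk' [gk [hk [q1 q2 q3 q4 q5]]]]] := happ _ e0.
  have el : eta = 2 * (eta / (2 + c)) + c * (eta / (2 + c)).
    by rewrite -mulrDl mulrC divfK// gt_eqF// addr_gt0.
  set e := eta / (2 + c) in e0 q2 q3 q4 q5 el.
  have ce : 0 < c * e by rewrite mulr_gt0.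
  exists wk, gk; split=> // x; first by apply: le_trans (q2 x) _; rewrite el; lra.
  have -> : gk x - G (x, wk x) = (gk x - (hk - c * (wk x - wk' x))) + (hk - h) +
      c * (wk' x - w' x) by rewrite /G /=; ring.
  apply: le_trans (ler_normD _ _) _.
  have := ler_normD (gk x - (hk - c * (wk x - wk' x))) (hk - h).
  have := q5 x; rewrite (normrM c) (gtr0_norm c0).
  have : c * `|wk' x - w' x| <= c * e by rewrite ler_pM2l.
  by rewrite el; lra.
split=> //.
- apply: (vsub_stability Hc Gc) => x eta eta0.
  have [wk [gk [[wkT s p] q2 q3]]] := approx _ eta0.
  exists wk; split; first exact: wkT.1.
  + by move=> y; have := q2 y; rewrite ler_norml; lra.
  + by have := q2 x; rewrite ler_norml; lra.
  + by apply: vsub_le s => y; have := q3 y; rewrite ler_norml; lra.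
- apply: (vsup_stability Hc Gc) => x eta eta0.
  have [wk [gk [[wkT s p] q2 q3]]] := approx _ eta0.
  exists wk; split; first exact: wkT.1.
  + by move=> y; have := q2 y; rewrite ler_norml; lra.
  + by have := q2 x; rewrite ler_norml; lra.
  + by apply: vsup_ge p => y; have := q3 y; rewrite ler_norml; lra.
Qed.

End Limit.

Section ErgodicExistence.
Context {R : realType} {n : nat}.
Local Notation V := 'rV[R]_n.
Implicit Types (H : V * V -> R).

Lemma ergodic_existence H1 H2 (c1 c2 : R) : (0 < n)%N -> 0 < c1 -> 0 < c2 ->
  torus_hamiltonian H1 -> torus_hamiltonian H2 ->
  steep_up_to_sign H1 c1 -> steep_up_to_sign H2 c2 ->
  exists w1 w2 (h : R), vsol H1 (fun x => h - c1 * (w1 x - w2 x)) w1 /\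
    vsol H2 (fun x => h - c2 * (w2 x - w1 x)) w2.
Proof.
move=> n0 c10 c20 t1 t2 st1 st2.
have [K [B [K0 B0 happ]]] := approximate_ergodic n0 c10 c20 t1 t2 st1 st2.
pose d k : R := harmonic k.
have d0 k : 0 < d k by rewrite /d /harmonic /= invr_gt0.
have dle1 k : d k <= 1 by rewrite /d /harmonic /= invf_le1 // ler1n.
have /choice[w1 h1] := fun k => happ _ (d0 k) (dle1 k).
have /choice[w2 h2] := h1.
have /choice[g1 h3] := h2.
have /choice[g2 h4] := h3.
have /choice[hh h5] := h4.
have [U [UU Uoo]] := ex_ultra_infty.
have [W1 [W1T W1l W1u]] : exists w, [/\ C_torus w, lip K w & forall e : R, 0 < e ->
    \forall k \near U, forall x, `|w1 k x - w x| <= e].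
  apply: (@ultra_uniform _ _ _ _ w1 K B K0) => k;
    by case: (h5 k) => [[[? _ _] _] [? _] [? _ _] _ _].
have [W2 [W2T W2l W2u]] : exists w, [/\ C_torus w, lip K w & forall e : R, 0 < e ->
    \forall k \near U, forall x, `|w2 k x - w x| <= e].
  apply: (@ultra_uniform _ _ _ _ w2 K B K0) => k;
    by case: (h5 k) => [[_ [? _ _]] [_ ?] [_ ? _] _ _].
have [h hl] : exists l : R, hh @ U --> l.
  by apply: (@ultra_lim _ _ _ _ B) => k; case: (h5 k) => _ _ [].
have dl : d @ U --> (0 : R) by exact: cvg_trans (cvg_app _ Uoo) (@cvg_harmonic R).
have ex (eta : R) : 0 < eta -> exists k, [/\ forall x, `|w1 k x - W1 x| <= eta,
    forall x, `|w2 k x - W2 x| <= eta, `|hh k - h| <= eta & B * d k <= eta].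
  move=> eta0.
  have n1 : \forall k \near U, `|hh k - h| < eta.
    by have /cvgrPdist_lt/(_ _ eta0) := hl; apply: filterS => k; rewrite distrC.
  have Bd : (fun k => B * d k) @ U --> B * 0 by apply: cvgM => //; exact: cvg_cst.
  have n2 : \forall k \near U, B * d k < eta.
    rewrite mulr0 in Bd; have /cvgrPdist_lt/(_ _ eta0) := Bd.
    by apply: filterS => k; rewrite sub0r normrN; exact: le_lt_trans (ler_norm _).
  have FU : Filter U by exact: filter_filter.
  have n3 := @filterI _ U FU _ _ (W1u _ eta0) (W2u _ eta0).
  have n4 := @filterI _ U FU _ _ n1 n2.
  have [k [[k1 k2] [k3 k4]]] := filter_ex (@filterI _ U FU _ _ n3 n4).
  by exists k; split=> //; exact: ltW.
exists W1, W2, h; split; apply: vsol_limit => //; [exact: t1.1| |exact: t2.1|].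
- move=> eta eta0; have [k [k1 k2 k3 k4]] := ex _ eta0.
  exists (w1 k), (w2 k), (g1 k), (hh k); case: (h5 k) => -[s1 s2] _ _ e1 e2.
  by split=> // x; apply: le_trans (e1 x) k4.
- move=> eta eta0; have [k [k1 k2 k3 k4]] := ex _ eta0.
  exists (w2 k), (w1 k), (g2 k), (hh k); case: (h5 k) => -[s1 s2] _ _ e1 e2.
  by split=> // x; apply: le_trans (e2 x) k4.
Qed.

End ErgodicExistence.

(** * Coercivity from the growth condition *)

Section DirectionalDerivative.
Context {R : realType} {n : nat}.
Local Notation V := 'rV[R]_n.
Implicit Types (x y z v w p : V) (f : V -> R).

Lemma mvt_line f v (d : V -> R) : (forall x, is_derive x v f (d x)) ->
  forall x (h : R), exists s : R, `|s| <= `|h| /\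
    f (h *: v + x) - f x = h * d (s *: v + x).
Proof.
move=> hd x h; pose l s := f (s *: v + x).
have dl (s : R) : is_derive s 1 l (d (s *: v + x)) by exact/is_derive_lineP.
have lc (a b : R) : {within `[a, b], continuous l}.
  by apply: derivable_within_continuous => s _; case: (dl s).
have l0 : l 0 = f x by rewrite /l scale0r add0r.
rewrite -l0 -/(l h); have [h0|h0] := leP 0 h.
  have [s] := @MVT_segment _ l _ 0 h h0 (fun s _ => dl s) (lc _ _).
  rewrite in_itv/= => /andP[s0 sh] E; exists s; split; first by rewrite !ger0_norm.
  by rewrite E subr0 mulrC.
have [s] := @MVT_segment _ l _ h 0 (ltW h0) (fun s _ => dl s) (lc _ _).
rewrite in_itv/= => /andP[hs s0] E; exists s; split.
  by rewrite (ltr0_norm h0) ler0_norm// lerN2.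
by rewrite -opprB E sub0r mulrN opprK mulrC.
Qed.

(** If the derivative along [v] is continuous, derivatives along [v] and [w] add up:
move along [w] first, then use the mean value theorem along [v]. *)
Lemma is_derive_dirD f v w (dv dw : V -> R) : continuous dv ->
  (forall x, is_derive x v f (dv x)) -> (forall x, is_derive x w f (dw x)) ->
  forall x, is_derive x (v + w) f (dv x + dw x).
Proof.
move=> dvc hv hw x.
have [c1 c2] := hw x.
have cw : (fun h : R => h^-1 *: ((f \o shift x) (h *: w) - f x)) @ 0^' --> dw x.
  by rewrite -c2; exact: c1.
have cv : (fun h : R => h^-1 *: (f (h *: v + (h *: w + x)) - f (h *: w + x))) @ 0^'
    --> dv x.
  apply/cvgrPdist_lt => e e0; have [d [d0 hd]] := cont_norm x dvc e0.
  have M0 : 0 < `|v| + `|w| + 1 by rewrite ltr_wpDl// addr_ge0.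
  have dM : 0 < d / (`|v| + `|w| + 1) by rewrite divr_gt0.
  near=> h.
  have h0 : h != 0 by near: h; exact: nbhs_dnbhs_neq.
  have hs : `|h| < d / (`|v| + `|w| + 1).
    near: h; apply: dnbhs0_lt; exact: dM.
  have [s [sh ->]] := mvt_line hv (h *: w + x) h.
  rewrite /GRing.scale/= mulKf// distrC; apply: hd.
  rewrite addrA addrK; apply: le_lt_trans (ler_normD _ _) _; rewrite !normrZ.
  apply: (@le_lt_trans _ _ (`|h| * (`|v| + `|w| + 1))).
    rewrite !mulrDr mulr1 -addrA lerD//; first by rewrite ler_wpM2r.
    by rewrite lerDl.
  by rewrite -ltr_pdivlMr.
have c : (fun h : R => h^-1 *: ((f \o shift x) (h *: (v + w)) - f x)) @ 0^' -->
    dv x + dw x.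
  apply: cvg_trans (cvgD cv cw); apply: near_eq_cvg; near=> h.
  rewrite fctE /= -scalerDr; congr (_ *: _).
  by rewrite scalerDr -(addrA (h *: v)); ring.
by apply: DeriveDef; [apply/cvg_ex; exists (dv x + dw x) | exact/cvg_lim].
Unshelve. all: by end_near. Qed.

Lemma is_derive_dirZ f v (c d : R) x : is_derive x v f d ->
  is_derive x (c *: v) f (d * c).
Proof.
move=> hd; have E : x = 0 *: (c *: v) + x by rewrite scale0r add0r.
rewrite {1}E; apply/is_derive_lineP.
have -> : (fun s : R => f (s *: (c *: v) + x)) =
    (fun s => f (s *: v + x)) \o (fun s => s * c).
  by apply/funext => s; rewrite /= scalerA.
apply: is_derive1_comp.
  by rewrite mul0r; apply/is_derive_lineP; rewrite scale0r add0r.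
have := is_deriveM (is_derive_id (0 : R) 1) (is_derive_cst c (0 : R) 1).
move=> h; apply: (is_derive_eq h).
by rewrite /GRing.scale/= mulr0 mulr1 add0r.
Qed.

Lemma C1_dir_derive f : Ck unitv 1 f ->
  forall x v, is_derive x v f (dotp (grad f x) v).
Proof.
move=> hf x v; rewrite {1}(row_sum_delta v) /dotp.
elim: (index_enum _) x => [|i s IH] x; first by rewrite !big_nil; exact: is_derive0.
rewrite !big_cons.
apply: (@is_derive_dirD f _ _ (fun x => grad f x 0 i * v 0 i)
  (fun x => \sum_(j <- s) grad f x 0 j * v 0 j)) => //.
- apply: contM; last exact: contC.
  exact: (cont_comp (C1_grad_cont hf) (@coord_cont _ _ i)).
- by move=> y; apply: is_derive_dirZ; exact: C1_is_derive.
Qed.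

End DirectionalDerivative.

Section Barrier.
Context {R : realType}.
Context {h dh : R -> R} (hd : forall t : R, is_derive t 1 h (dh t)).

Lemma barrier_cont : continuous h.
Proof.
by move=> t; apply/differentiable_continuous/derivable1_diffP; case: (hd t).
Qed.

Lemma right_increase (t : R) : 0 < dh t ->
  exists e : R, 0 < e /\ forall s, 0 < s -> s < e -> h t < h (s + t).
Proof.
move=> d0; have [c1 c2] := hd t.
have : (fun s : R => s^-1 *: ((h \o shift t) (s *: (1 : R)) - h t)) @ 0^' --> dh t.
  by rewrite -c2; exact: c1.
move=> /cvgr_gt/(_ _ d0)[e /= e0 he]; exists e; split=> // s s0 se.
have := he s; rewrite /= sub0r normrN gtr0_norm// => /(_ se).
rewrite gt_eqF// => /(_ isT).
by rewrite /GRing.scale/= mulr1 pmulr_rgt0 ?invr_gt0// subr_gt0.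
Qed.

(** A level crossed only upwards is never left downwards: look at the last time the
trajectory is above it. *)
Lemma barrier (K : R) : (forall t, `|h t| < K -> 0 < dh t) ->
  forall t0 t, `|h t0| < K -> t0 <= t -> h t0 <= h t.
Proof.
move=> hK t0 t h0 t0t; rewrite leNgt; apply/negP => hlt.
set a := h t0 in h0 hlt.
pose S := [set s | [/\ t0 <= s, s <= t & a <= h s]].
have Sup : has_sup S.
  by split; [exists t0; split | exists t => s []].
pose s0 := sup S.
have s0t : s0 <= t by apply: sup_le_ub; [case: Sup | move=> s []].
have t0s0 : t0 <= s0 by apply: sup_upper_bound => //; split.
have after s : s0 < s -> s <= t -> h s < a.
  move=> s1 s2; rewrite ltNge; apply/negP => s3.
  have : s <= s0.
    by apply: sup_upper_bound => //; split=> //; apply: le_trans t0s0 (ltW s1).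
  by rewrite leNgt s1.
have hs0 : a <= h s0.
  rewrite leNgt; apply/negP => bad.
  have /cvgr_lt/(_ _ bad)/nbhs_ballP[e /= e0 he] := @barrier_cont s0.
  have [s [s1 s2 s3] s4] := sup_adherent e0 Sup.
  have ss0 : s <= s0 by apply: sup_upper_bound => //; split.
  have : h s < a.
    by apply: he; rewrite /ball /= ger0_norm ?subr_ge0//; move: s4; rewrite -/s0; lra.
  by rewrite ltNge s3.
have s0lt : s0 < t.
  by rewrite lt_neqAle s0t andbT; apply/eqP => E; move: hs0; rewrite E leNgt hlt.
have [e [e0 he]] : exists e : R, 0 < e /\ forall s, 0 < s -> s < e -> a <= h (s + s0).
  move: hs0; rewrite le_eqVlt => /orP[/eqP aE|agt].
    have d0 : 0 < dh s0 by apply: hK; rewrite -aE.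
    have [e [e0 he]] := right_increase d0; exists e; split=> // s s1 s2.
    by rewrite aE ltW// he.
  have /cvgr_gt/(_ _ agt)/nbhs_ballP[e /= e0 he] := @barrier_cont s0.
  exists e; split=> // s s1 s2; apply/ltW/he.
  by rewrite /ball /= opprD addrCA subrr addr0 normrN gtr0_norm.
pose s := Num.min (e / 2) (t - s0).
have [q1 q2] : s <= e / 2 /\ s <= t - s0 by rewrite /s !ge_min !lexx ?orbT.
have s_gt0 : 0 < s by rewrite lt_min divr_gt0 // subr_gt0.
have h1 := he s s_gt0 ltac:(lra).
have h2 := after (s + s0) ltac:(lra) ltac:(lra).
by move: h2; rewrite ltNge h1.
Qed.

End Barrier.

Section Coercivity.
Context {R : realType} {n : nat}.
Local Notation V := 'rV[R]_n.
Implicit Types (x y z v w p : V) (f : V -> R) (H : V * V -> R).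

(** Two of the bounded points [j * p], reduced modulo the integer lattice, are close. *)
Lemma recurrence p (e : R) : 0 < e -> exists (N : nat) (k : 'rV[int]_n),
  (0 < N)%N /\ `|N%:R *: p + map_mx intr k| < e.
Proof.
move=> e0.
have /choice[z hz] : forall j : nat, exists k : 'rV[int]_n,
    `|j%:R *: p + map_mx intr k| <= 1.
  by move=> j; have [k hk] := unit_translate (j%:R *: p) 0; exists k; rewrite subr0 in hk.
pose y j := j%:R *: p + map_mx intr (z j).
have [U [UU Uoo]] := ex_ultra_infty.
have [l hl] : exists l : V, y @ U --> l by exact: (@ultra_lim_rV _ _ _ _ y 1).
have e2 : 0 < e / 2 by rewrite divr_gt0.
have /cvgrPdist_lt/(_ _ e2) near1 := hl.
have [j1 hj1] := filter_ex near1.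
have near2 : \forall j \near U, (j1 < j)%N.
  by apply: Uoo; exists j1.+1.
have [j2 [hj2 j12]] := filter_ex (filterI near1 near2).
exists (j2 - j1)%N, (z j2 - z j1); rewrite subn_gt0; split=> //.
have -> : (j2 - j1)%:R *: p + map_mx intr (z j2 - z j1) = (l - y j1) - (l - y j2).
  have -> : l - y j1 - (l - y j2) = y j2 - y j1.
    by rewrite opprB addrC addrA subrK.
  by rewrite natrB ?(ltnW j12)// scalerBl map_mxB /y opprD addrACA.
by apply: le_lt_trans (ler_normB _ _) _; move: hj1 hj2 => /= *; lra.
Qed.

(** Along the line of direction [p] the Hamiltonian can only cross the band
[|H| < K] upwards, which is incompatible with the recurrence of this line on the
torus; hence the band is never entered. *)
Lemma band_avoided f p (K : R) : Ck unitv 1 f -> Zn_periodic f ->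
  (forall x, `|f x| < K -> 0 < dotp (grad f x) p) -> forall x, K <= `|f x|.
Proof.
move=> hf fper hK x; rewrite leNgt; apply/negP => hx.
pose h (t : R) := f (t *: p + x).
have hd t : is_derive (t : R) 1 h (dotp (grad f (t *: p + x)) p).
  exact/is_derive_lineP/C1_dir_derive.
have h0 : h 0 = f x by rewrite /h scale0r add0r.
have hc := barrier_cont hd.
have d0 : 0 < dotp (grad f (0 *: p + x)) p by rewrite scale0r add0r; exact: hK.
have [e [e0 he]] := right_increase hd d0.
have hK0 : h 0 < K by rewrite h0; apply: le_lt_trans hx; exact: ler_norm.
have /cvgr_lt/(_ _ hK0)/nbhs_ballP[e1 /= e10 he1] := hc 0.
(* shortly after the start h is still in the band and strictly above h 0; the return
   time N is at least t *)
pose t := Num.min (Num.min (e / 2) (e1 / 2)) 1.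
have t0 : 0 < t by rewrite !lt_min !divr_gt0 //=.
have [q1 q2 q3] : [/\ t <= e / 2, t <= e1 / 2 & t <= 1].
  by split; rewrite /t !ge_min ?lexx ?orbT.
have ht : h 0 < h t by have := he t t0; rewrite addr0; apply; lra.
have htK : `|h t| < K.
  rewrite ltr_norml; apply/andP; split.
    by apply: lt_trans ht; rewrite h0; move: hx; rewrite ltr_norml => /andP[].
  by apply: he1; rewrite /ball /= sub0r normrN gtr0_norm//; lra.
have gap : 0 < h t - h 0 by rewrite subr_gt0.
have [d [dd0 hdd]] := cont_norm x (C1_cont hf) gap.
have [N [k [N0 hN]]] := recurrence p dd0.
have := barrier hd (K := K) (fun s hs => hK _ hs) htK (t := N%:R).
have tN : t <= N%:R by apply: le_trans q3 _; rewrite ler1n.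
move=> /(_ tN).
have : `|h N%:R - h 0| < h t - h 0.
  have -> : h N%:R = f (N%:R *: p + x + map_mx intr k) by rewrite fper.
  by rewrite -h0 in hdd; apply: hdd; rewrite addrAC addrK.
by rewrite ltr_norml; lra.
Qed.

Lemma smooth_C1 H p : smooth_hamiltonian H -> Ck unitv 1 (fun x => H (x, p)).
Proof.
move=> [_ hH]; have [Hc hd] := hH 1%N.
have pc : continuous (fun x : V => (x, p)).
  by apply: contP; [exact: cont_id | exact: contC].
have E x i : (fun h : R => h^-1 *: ((H \o shift (x, p)) (h *: unitv2 (inl i)) - H (x, p)))
  = (fun h => h^-1 *: (((fun x => H (x, p)) \o shift x) (h *: unitv i) - H (x, p))).
  apply/funext => h /=; congr (_ *: (H _ - _)).
  by rewrite /unitv2; congr pair; rewrite /= scaler0 add0r.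
have [] // := @C1_intro R n (fun x => H (x, p))
   (fun x => \row_i 'D_(unitv2 (inl i)) H (x, p)).
- move=> x i; have [d1 d2] := hd (inl i).
  rewrite mxE; split; first by have := d1 (x, p); rewrite /derivable E.
  by rewrite /derive -E.
- exact: (cont_comp pc Hc).
- apply: continuous_rowP => i; have [d1 [d2 _]] := hd (inl i).
  have -> : (fun x : V => (\row_i 'D_(unitv2 (inl i)) H (x, p) : V) 0 i) =
      (fun x => 'D_(unitv2 (inl i)) H (x, p)) by apply/funext => x; rewrite mxE.
  exact: (cont_comp pc d2).
Qed.

Lemma growth_band H (c omega : R) : smooth_hamiltonian H -> 0 < c -> 0 < omega ->
  growth_condition c omega H -> exists r : R, forall x p, r < enorm p ->
  4 * Num.sqrt n%:R * c * enorm p <= `|H (x, p)|.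
Proof.
move=> hH c0 o0 /(_ 0)[r hr]; exists r => x p hp.
apply: (@band_avoided (fun x => H (x, p)) p) => [||{}x hx].
- exact: smooth_C1.
- exact: hH.1.
have := hr x p hp; set g := dotp _ _.
have -> : 16 * n%:R * omega * c ^+ 2 * enorm p ^+ 2 =
    omega * (4 * Num.sqrt n%:R * c * enorm p) ^+ 2.
  by rewrite !exprMn (sqr_sqrtr (ler0n R n)); ring.
have : `|H (x, p)| ^+ 2 < (4 * Num.sqrt n%:R * c * enorm p) ^+ 2.
  by rewrite ltr_sqr ?nnegrE//; apply: le_trans (ltW hx).
rewrite -(ltr_pM2l o0) => ab h.
by move: h ab; lra.
Qed.

Lemma same_sign_segment (F : V * V -> R) (z0 z1 : V * V) : continuous F ->
  (forall s : R, F (z0 + s *: (z1 - z0)) != 0) -> 0 < F z0 -> 0 < F z1.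
Proof.
move=> Fc hF F0; rewrite ltNge; apply/negP => F1.
pose f (s : R) := F (z0 + s *: (z1 - z0)).
have fc : continuous f.
  apply: (cont_comp _ Fc); apply: contD; first exact: contC.
  by apply: contZ; [exact: cont_id | exact: contC].
have f0 : f 0 = F z0 by rewrite /f scale0r addr0.
have f1 : f 1 = F z1 by rewrite /f scale1r addrC subrK.
have [|s _ /eqP fs] := @IVT R f 0 1 0 ler01 (continuous_subspaceT fc).
  by rewrite f0 f1 ge_min F1 orbT le_max (ltW F0).
by move: fs; rewrite (negPf (hF s)).
Qed.

(** For [n >= 2] the complement of a cube is connected by segments parallel to
coordinate hyperplanes: keep one large coordinate while the others move to [r + 1],
then move the last one. *)
Lemma same_sign_outside_cube (F : V * V -> R) (r : R) : (2 <= n)%N -> 0 <= r ->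
  continuous F -> (forall x p i, r < `|p 0 i| -> F (x, p) != 0) ->
  forall x p i, r < `|p 0 i| -> 0 < F (x, p) -> 0 < F (0, const_mx (r + 1)).
Proof.
move=> n2 r0 Fc hF x p i pi F0.
pose p1 : V := \row_j if j == i then p 0 i else r + 1.
have h1 : 0 < F (0, p1).
  apply: (same_sign_segment Fc _ F0) => s.
  apply: (hF (x + s *: (0 - x)) _ i).
  by rewrite !mxE eqxx subrr mulr0 addr0.
have [j ji] : exists j : 'I_n, j != i.
  have n0 : (0 < n)%N by exact: ltn_trans n2.
  have [i0|i0] := eqVneq (i : nat) 0%N.
    by exists (Ordinal n2); rewrite -val_eqE /= i0.
  by exists (Ordinal n0); rewrite -val_eqE /= eq_sym.
apply: (same_sign_segment Fc _ h1) => s.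
apply: (hF (0 + s *: (0 - 0)) _ j).
rewrite !mxE (negPf ji) subrr mulr0 addr0 gtr0_norm; lra.
Qed.

(** The radius is multiplied by [sqrt n] because the connectedness argument is carried
out for cubes. *)
Lemma growth_steep H (c omega : R) : (2 <= n)%N -> smooth_hamiltonian H ->
  0 < c -> 0 < omega -> growth_condition c omega H -> steep_up_to_sign H c.
Proof.
move=> n2 hH c0 o0 hg; have [r0 hr0] := growth_band hH c0 o0 hg.
have n0 : (0 < n)%N by exact: ltn_trans n2.
pose r := Num.max r0 0.
have rge : 0 <= r by rewrite le_max lexx orbT.
have s0 : 0 < Num.sqrt n%:R :> R by rewrite sqrtr_gt0 ltr0n.
have Hc : continuous H by exact: (hH.2 0%N).1.
have large x p : r < enorm p -> 4 * Num.sqrt n%:R * c * enorm p <= `|H (x, p)|.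
  by move=> hp; apply: hr0; apply: le_lt_trans hp; rewrite le_max lexx.
have coord p i : r < `|p 0 i| -> r < enorm p.
  move=> hp; apply: lt_le_trans hp (le_trans (ler_coord_norm p i) _).
  exact: norm_le_enorm.
have nz x p : r < enorm p -> 0 < `|H (x, p)|.
  move=> hp; apply: lt_le_trans (large x p hp); rewrite !mulr_gt0//.
  exact: le_lt_trans hp.
have cube p : Num.sqrt n%:R * r < enorm p -> exists i, r < `|p 0 i|.
  move=> hp; apply: contrapT => hno.
  have : `|p| <= r.
    apply: ler_norm_coord => // i; rewrite leNgt; apply/negP => hi.
    by apply: hno; exists i.
  rewrite leNgt => /negP; apply; rewrite -(ltr_pM2l s0).
  exact: lt_le_trans hp (enorm_le_norm p).
have nzH x p i : r < `|p 0 i| -> H (x, p) != 0.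
  by move=> /coord/(nz x); rewrite normr_gt0.
have nzN x p i : r < `|p 0 i| -> - H (x, p) != 0.
  by move=> hi; rewrite oppr_eq0; exact: nzH hi.
pose P : V := const_mx (r + 1).
have [HP|HP] := ltP 0 (H (0, P)); [left|right]; exists (Num.sqrt n%:R * r) => x p hp.
- have [i hi] := cube p hp; have := large x p (coord p i hi).
  have [hneg|hpos] := ltP (H (x, p)) 0; last by rewrite ger0_norm.
  have : 0 < - H (0, P).
    have := @same_sign_outside_cube (fun z : V * V => - H z) r n2 rge
      (contN Hc) nzN x p i hi.
    by rewrite oppr_gt0; apply.
  by rewrite oppr_gt0 ltNge (ltW HP).
- have hp' : Num.sqrt n%:R * r < enorm (- p) by rewrite enormN.
  have [i hi] := cube _ hp'; have := large x _ (coord _ i hi); rewrite /flipH /= enormN.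
  have [hpos|hneg] := ltP 0 (H (x, - p)); last by rewrite ler0_norm.
  have := @same_sign_outside_cube H r n2 rge Hc nzH x (- p) i hi hpos.
  by rewrite ltNge HP.
Qed.

End Coercivity.

(** * The ergodic constant *)

Section Uniqueness.
Context {R : realType} {n : nat}.
Local Notation V := 'rV[R]_n.
Implicit Types (H : V * V -> R) (u v : V -> R).

Lemma system_vsol (c1 c2 : R) H1 H2 (h1 h2 : R) u1 u2 :
  system_viscosity_solution c1 c2 H1 H2 h1 h2 u1 u2 <->
  vsol H1 (fun x => h1 - c1 * (u1 x - u2 x)) u1 /\
  vsol H2 (fun x => h2 - c2 * (u2 x - u1 x)) u2.
Proof.
split=> [[T1 T2 [s1 p1] [s2 p2]]|[[T1 s1 p1] [T2 s2 p2]]].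
  split; split=> // phi x hphi hx.
  - by have := s1 phi x hphi hx; lra.
  - by have := p1 phi x hphi hx; lra.
  - by have := s2 phi x hphi hx; lra.
  - by have := p2 phi x hphi hx; lra.
split=> //; split=> phi x hphi hx.
- by have := s1 phi x hphi hx; lra.
- by have := p1 phi x hphi hx; lra.
- by have := s2 phi x hphi hx; lra.
- by have := p2 phi x hphi hx; lra.
Qed.

(** At the maxima of [u1 - v1] and of [u2 - v2] the comparison of the equations
bounds the differences of the constants by multiples of the same difference of
maxima with opposite signs, which cancels in the weighted sum. *)
Lemma ergodic_constant_le H1 H2 (c1 c2 h1 h2 k1 k2 : R) u1 u2 v1 v2 :
  0 < c1 -> 0 < c2 -> continuous H1 -> continuous H2 ->
  coercive_up_to_sign H1 -> coercive_up_to_sign H2 ->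
  vsol H1 (fun x => h1 - c1 * (u1 x - u2 x)) u1 ->
  vsol H2 (fun x => h2 - c2 * (u2 x - u1 x)) u2 ->
  vsol H1 (fun x => k1 - c1 * (v1 x - v2 x)) v1 ->
  vsol H2 (fun x => k2 - c2 * (v2 x - v1 x)) v2 ->
  c2 * k1 + c1 * k2 <= c2 * h1 + c1 * h2.
Proof.
move=> c10 c20 H1c H2c co1 co2 [U1 su1 _] [U2 su2 _] [V1 _ sv1] [V2 _ sv2].
have T (h c : R) (w w' : V -> R) : C_torus w -> C_torus w' ->
    C_torus (fun x => h - c * (w x - w' x)).
  move=> hw hw'; apply: C_torusD; first exact: C_torusC.
  apply/C_torusN/C_torusZ; apply: C_torusD => //; exact: C_torusN.
have [x1 [m1 e1]] := comparison H1c co1 (T h1 c1 _ _ U1 U2)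
  (T k1 c1 _ _ V1 V2) U1 V1 su1 sv1.
have [x2 [m2 e2]] := comparison H2c co2 (T h2 c2 _ _ U2 U1)
  (T k2 c2 _ _ V2 V1) U2 V2 su2 sv2.
pose M1 := u1 x1 - v1 x1; pose M2 := u2 x2 - v2 x2.
have q1 : k1 - h1 <= c1 * (M2 - M1).
  have : c1 * (u2 x1 - v2 x1 - M1) <= c1 * (M2 - M1).
    by rewrite ler_pM2l// lerD2r; exact: m2.
  by move: e1; rewrite /M1; lra.
have q2 : k2 - h2 <= c2 * (M1 - M2).
  have : c2 * (u1 x2 - v1 x2 - M2) <= c2 * (M1 - M2).
    by rewrite ler_pM2l// lerD2r; exact: m1.
  by move: e2; rewrite /M2; lra.
have r1 : c2 * (k1 - h1) <= c2 * (c1 * (M2 - M1)) by rewrite ler_pM2l.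
have r2 : c1 * (k2 - h2) <= c1 * (c2 * (M1 - M2)) by rewrite ler_pM2l.
by lra.
Qed.

End Uniqueness.

Theorem theorem1p3 (R : realType) (n : nat) (hn : (2 <= n)%N)
    (c1 c2 : R) (hc1 : 0 < c1) (hc2 : 0 < c2)
    (H1 H2 : 'rV[R]_n * 'rV[R]_n -> R)
    (hH1 : smooth_hamiltonian H1) (hH2 : smooth_hamiltonian H2)
    (hgrowth : exists omega1 omega2 : R,
       [/\ 0 < omega1, 0 < omega2,
           growth_condition c1 omega1 H1 & growth_condition c2 omega2 H2]) :
  exists! mu : R, forall h1 h2 : R,
    (exists u1 u2 : 'rV[R]_n -> R,
       system_viscosity_solution c1 c2 H1 H2 h1 h2 u1 u2) ->
    c2 * h1 + c1 * h2 = mu.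
Proof.
have [omega1 [omega2 [om1 om2 g1 g2]]] := hgrowth.
have n0 : (0 < n)%N by exact: ltn_trans hn.
have st1 := growth_steep hn hH1 hc1 om1 g1.
have st2 := growth_steep hn hH2 hc2 om2 g2.
have co1 := steep_up_to_sign_coercive n0 hc1 st1.
have co2 := steep_up_to_sign_coercive n0 hc2 st2.
have t1 : torus_hamiltonian H1 by split; [exact: (hH1.2 0%N).1 | exact: hH1.1].
have t2 : torus_hamiltonian H2 by split; [exact: (hH2.2 0%N).1 | exact: hH2.1].
have [w1 [w2 [h [s1 s2]]]] := ergodic_existence n0 hc1 hc2 t1 t2 st1 st2.
exists (c2 * h + c1 * h); split.
  move=> h1 h2 [u1 [u2 /system_vsol[r1 r2]]]; apply/eqP; rewrite eq_le.
  by apply/andP; split; apply: ergodic_constant_le hc1 hc2 t1.1 t2.1 co1 co2 _ _ _ _;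
    eassumption.
move=> mu; apply; exists w1, w2; exact/system_vsol.
Qed.
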